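(* For each integer $n>0$, the Alexander polynomial of the twisted torus knot $$T(6n-1,\, 2n;\, 3n,\,-1)$$ has leading coefficient $n$ and degree $(3n-2)(n-1)$.
   Context: Twisted torus knots: for relatively prime integers $p$ and $q$, and integers $0<r\le |p|+|q|$ and $s\in\mathbb{Z}$, the twisted torus knot $T(p,q;r,s)\subset S^3$ is the knot obtained from the standard diagram of the $(p,q)$-torus knot on the flat torus by applying $s$ full twists on $r$ adjacent strands. For $p,q>0$ the torus knot $T(p,q)$ is positive, and a full twist with $s>0$ has the same sign as the crossings of the positive torus knot. Concretely, when $p>q>0$ and $r\le p$ (which is the case here), $T(p,q;r,s)$ is the closure of the $p$-strand braid $(\sigma_1\sigma_2\cdots\sigma_{p-1})^q(\sigma_1\sigma_2\cdots\sigma_{r-1})^{rs}$, where the $\sigma_i$ are the standard generators of the braid group on $p$ strands. Alexander polynomial conventions: the Alexander polynomial $\Delta_K(t)\in\mathbb{Z}[t,t^{-1}]$ of a knot $K\subset S^3$ is defined only up to multiplication by $\pm t^k$, $k\in\mathbb{Z}$. Its leading coefficient means the absolute value of the coefficient of the highest-degree term, and its degree means the difference between the highest and lowest exponents occurring with nonzero coefficient. *)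

(* Defs.v *)
From HB Require Import structures.
From mathcomp Require Import all_boot all_order all_algebra.

Set Implicit Arguments.
Unset Strict Implicit.
Unset Printing Implicit Defensive.

Import GRing.Theory.
Local Open Scope ring_scope.

(** * Oriented link diagrams and their Alexander polynomial *)

(* The edges are the oriented segments into which the diagram is cut at its
   crossings (further cuts at non-crossing points are allowed).  [prev e] is
   the edge of the same strand that runs into [e].  [over e = Some (o, b)]
   means that between [prev e] and [e] the strand passes under the strand
   containing the edge [o], at a crossing which is positive (right-handed)
   iff [b].  [over e = None] means that the strand goes over a crossing, or
   that there is no crossing, between [prev e] and [e]. *)
Record diagram := Diagram {
  edge : finType;
  prev : edge -> edge;
  over : edge -> option (edge * bool) }.

(* Wirtinger relations, abelianized by Fox calculus.  If an over-strand [o]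
   has the under-edge [l] on its left and [r] on its right, the relation is
   (1 - t) o + t l - r = 0.  The outgoing under-edge is on the left at a
   positive crossing and on the right at a negative one.  Where there is no
   undercrossing the relation identifies [prev e] with [e]. *)
Definition alexander_entry (D : diagram) (e f : edge D) : {poly int} :=
  match over e with
  | None => (f == prev e)%:R - (f == e)%:R
  | Some (o, true) =>
      (1 - 'X) * (f == o)%:R + 'X * (f == e)%:R - (f == prev e)%:R
  | Some (o, false) =>
      (1 - 'X) * (f == o)%:R + 'X * (f == prev e)%:R - (f == e)%:R
  end.

Definition alexander_matrix (D : diagram) : 'M[{poly int}]_#|edge D| :=
  \matrix_(i, j) alexander_entry (enum_val i) (enum_val j).

(* Equality up to multiplication by a unit +/- t^k (k an integer) of
   Z[t, t^-1], for Laurent polynomials that lie in Z[t]. *)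
Definition laurent_assoc (f g : {poly int}) : Prop :=
  exists (a b : nat) (c : bool), 'X^a * f = (-1) ^+ c * 'X^b * g.

(* The Alexander polynomial is only defined up to units, so it is a predicate:
   [P] is any representative in Z[t] of the determinant obtained by deleting
   one row and one column, arbitrarily chosen, of the Alexander matrix. *)
Definition is_alexander_poly (D : diagram) (P : {poly int}) : Prop :=
  exists i j : 'I_#|edge D|,
    laurent_assoc P (\det (row' i (col' j (alexander_matrix D)))).

Definition leading_coefficient (P : {poly int}) : nat := `|lead_coef P|%N.

Definition lowest_exponent (P : {poly int}) : nat := find (predC1 0) P.

Definition laurent_degree (P : {poly int}) : nat :=
  ((size P).-1 - lowest_exponent P)%N.

(** * Closed braids *)

(* On p strands, at positions 0, ..., p - 1 from left to right, the letter
   [(g, true)] is the standard generator exchanging the positions g and g + 1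
   (sigma_(g+1) in the usual numbering), and [(g, false)] is its inverse. *)
Definition braid_word (p : nat) := seq ('I_p.-1 * bool).

Definition braid_inv p (w : braid_word p) : braid_word p :=
  rev [seq (x.1, ~~ x.2) | x <- w].

Definition braid_exp p (w : braid_word p) (k : int) : braid_word p :=
  match k with
  | Posz n => flatten (nseq n w)
  | Negz n => flatten (nseq n.+1 (braid_inv w))
  end.

Definition swap_adjacent p (g : 'I_p.-1) (i : 'I_p) : 'I_p :=
  insubd i (if val i == g then g.+1 else if val i == g.+1 then val g else val i).

(* Strands run upwards.  The edge (k, i) is the segment at position i just
   above the k-th letter, so the edges just below that letter are the
   (k - 1, i), with k - 1 taken cyclically.  In a positive letter g the strand
   going from g to g + 1 is the over-strand, hence the strand that arrives at g
   has passed under the edge (k - 1, g); in a negative letter the strand that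
   arrives at g + 1 has passed under (k - 1, g + 1).  The word is meant to be
   nonempty. *)
Definition closed_braid p (w : braid_word p) : diagram :=
  @Diagram ('I_(size w) * 'I_p)%type
    (fun e => let x := tnth (in_tuple w) e.1 in
       (ord_pred e.1, swap_adjacent x.1 e.2))
    (fun e => let x := tnth (in_tuple w) e.1 in
       if val e.2 == (if x.2 then val x.1 else x.1.+1)
       then Some ((ord_pred e.1, e.2), x.2) else None).

(** * Twisted torus knots *)

(* sigma_1 sigma_2 ... sigma_(r-1), for r <= p *)
Definition sigma_chain (p r : nat) : braid_word p :=
  [seq (g, true) | g : 'I_p.-1 <- enum 'I_p.-1 & (g < r.-1)%N].

Definition twisted_torus_braid (p q r : nat) (s : int) : braid_word p :=
  braid_exp (sigma_chain p p) q ++ braid_exp (sigma_chain p r) (r%:Z * s).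

(* T(p, q; r, s) for coprime p > q > 0, 0 < r <= p and any integer s. *)
Definition twisted_torus_knot (p q r : nat) (s : int) : diagram :=
  closed_braid (twisted_torus_braid p q r s).

(* Main.v *)
Require Import Defs.
From HB Require Import structures.
From mathcomp Require Import all_boot all_order all_algebra fingroup perm.
From mathcomp Require Import ring zify.

Set Implicit Arguments.
Unset Strict Implicit.
Unset Printing Implicit Defensive.

Import GRing.Theory.
Local Open Scope ring_scope.

(** The Alexander matrix of a closed braid has a right null vector (all ones)
   and a left null vector with entries +/- t^k, and this alone ties all its
   cofactors together: if k and l are right and left null vectors of A, then
   each cofactor is, up to known factors, det (A + x y) for any column x and
   row y with l x and y k nonzero ([cofactor_of_null_vectors]).  Taking x on the
   first level of the braid and y on the last one, the large determinant
   collapses to the size p of the braid: a minor times (1 + ... + t^(p-1)) times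
   the sum of y is a unit times det (1 - B + 1 y), where B is the unreduced
   Burau matrix of the braid ([det_cyclic_blocks], [closed_braid_minor]).

   Let K_m be the Burau matrix of the inverse of the chain s_1 ... s_(m-1).
   A chain rotates the strands, so K_p^q is t^q times a cyclic
   shift R by q places, plus a matrix 1 y_q all of whose rows are equal, and
   K_r^r (an inverse full twist) is t^r on the first r strands, 1 elsewhere, plus
   a matrix of rank one.  For the twisted torus braid B = K_r^r K_p^(-q), so
   that a suitable y absorbs 1 y_q, and what is left is the determinant of
   D - t^q R + u v, with D diagonal and u v of rank one ([twisted_torus_minor]).

   For p = 6n-1, q = 2n, r = 3n one has 3q = p + 1, so that three shifts by q move
   a strand to its neighbour.  Hence the p-cycle R meets the first r strands in
   a completely regular pattern, det (D - t^q R) is a unit times 1 - t^E with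
   E = pq - r^2 = n(3n-2), and (D - t^q R) Y = u has an explicit solution
   ([resolvent_first_return]).  So, up to units, the Alexander polynomial
   times (1 + ... + t^(p-1)) (t^q - 1) equals
     H = t^(4n) (1 - t^E) + (1 - t) (t^0 Y_(r-1) + ... + t^(r-1) Y_0)
   for a rescaled Y ([det_twisted_torus]).  Only the extreme terms of H matter,
   because extreme coefficients and degrees are multiplicative: its constant
   term is n, and its top term is - n t^(E+5n).  The known factor has
   extreme coefficients -1 and 1 and degree p + q - 1 = 8n - 2, whence the
   leading coefficient n and the degree E + 5n - (8n - 2) = (3n-2)(n-1). *)

(** * Determinants of low-rank perturbations *)

Lemma det_add1_mulmxC (R : comNzRingType) m n (X : 'M[R]_(m, n)) (Y : 'M_(n, m)) :
  \det (1%:M + X *m Y) = \det (1%:M + Y *m X).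
Proof.
have e1 : block_mx 1%:M (- X) Y 1%:M =
    block_mx 1%:M 0 Y 1%:M *m block_mx 1%:M (- X) 0 (1%:M + Y *m X).
  by rewrite mulmx_block !mul1mx !mul0mx !mulmx1 ?mulmx0 !addr0 mulmxN [- _ + _]addrC addrK.
have e2 : block_mx 1%:M (- X) Y 1%:M =
    block_mx 1%:M (- X) 0 1%:M *m block_mx (1%:M + X *m Y) 0 Y 1%:M.
  by rewrite mulmx_block !mul1mx !mul0mx !mulmx1 ?mulmx0 ?add0r ?addr0 mulNmx addrK.
have := congr1 determinant e2; rewrite {1}e1 !det_mulmx.
by rewrite !det_lblock !det_ublock !det1 !mul1r mulr1 => ->.
Qed.

Lemma det_add_mulmx (R : comNzRingType) m k (A : 'M[R]_m) (X Z : 'M_(m, k)) (Y : 'M_(k, m)) :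
  A *m Z = X -> \det (A + X *m Y) = \det A * \det (1%:M + Y *m Z).
Proof.
move=> <-; rewrite -det_add1_mulmxC -det_mulmx.
by rewrite mulmxDr mulmx1 mulmxA.
Qed.

Lemma det_add_rank1 (R : comNzRingType) m (A : 'M[R]_m) (x z : 'cV_m) (y : 'rV_m) :
  A *m z = x -> \det (A + x *m y) = \det A * (1 + (y *m z) 0 0).
Proof. by move/det_add_mulmx->; rewrite det_mx11 !mxE. Qed.

(** A permutation s that contributes to the Leibniz formula never increases the
   rank f, while the sum of f (s i) over all i is the sum of f i: so f (s i) = f i
   everywhere, and s is the identity.  An explicit rank spares the reordering
   of the index type that would make the matrix literally triangular. *)
Lemma det_ranked_triangular (R : comNzRingType) m (A : 'M[R]_m) (f : 'I_m -> nat) :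
  (forall i j, A i j != 0 -> i != j -> (f j < f i)%N) ->
  \det A = \prod_i A i i.
Proof.
move=> tri; rewrite /determinant (bigD1 (1%g : 'S_m)) //= [X in _ + X]big1 ?addr0.
  by rewrite odd_perm1 expr0 mul1r; apply: eq_bigr => i _; rewrite perm1.
move=> s s_neq1; apply/eqP/negPn/negP => nz.
have nzi i : A i (s i) != 0.
  by apply: contraNneq nz => z; rewrite (bigD1 i) //= z mul0r mulr0.
have [i si] : exists i, s i != i.
  apply/existsP; apply: contraNT s_neq1 => /existsPn h.
  apply/eqP/permP => i; rewrite perm1; exact/eqP/negPn/h.
have le j : (f (s j) <= f j)%N.
  have [->//|ne] := eqVneq (s j) j.
  by apply/ltnW/tri; rewrite // eq_sym.
have lt : (f (s i) < f i)%N by apply: tri; rewrite // eq_sym.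
suff : (\sum_j f (s j) < \sum_j f j)%N.
  by rewrite [X in (_ < X)%N](reindex_inj (@perm_inj _ s)) /= ltnn.
rewrite (bigD1 i) //= [X in (_ < X)%N](bigD1 i) //=.
by rewrite -addSn leq_add // leq_sum.
Qed.

(** Right multiplication by 1 + k z fixes A, since A k = 0, and z can be chosen
   to turn y into y'. *)
Lemma det_rank1_change_row (F : fieldType) m (A : 'M[F]_m) (x : 'cV_m)
    (y y' : 'rV_m) (k : 'cV_m) :
  A *m k = 0 -> (y *m k) 0 0 != 0 ->
  \det (A + x *m y') * (y *m k) 0 0 = \det (A + x *m y) * (y' *m k) 0 0.
Proof.
set s := (y *m k) 0 0 => Ak s0.
pose z := s^-1 *: (y' - y).
have eqH : (A + x *m y) *m (1%:M + k *m z) = A + x *m y'.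
  rewrite mulmxDr mulmx1 mulmxDl mulmxA Ak mul0mx add0r -mulmxA (mulmxA y).
  have -> : y *m k = s%:M by rewrite [LHS]mx11_scalar.
  by rewrite mul_scalar_mx scalerA mulfV // scale1r -addrA -mulmxDr [y + _]addrC subrK.
rewrite -eqH det_mulmx det_add1_mulmxC det_mx11 -mulrA; congr (_ * _).
have -> : (1%:M + z *m k) 0 0 = 1 + s^-1 * ((y' *m k) 0 0 - s).
  by rewrite /z -scalemxAl mulmxBl /s; do ![rewrite mxE].
by field.
Qed.

(** A cofactor of a singular matrix is itself a determinant of a rank-one
   perturbation, by the matrix unit at (i, j); the row and then the column of
   the perturbation are exchanged for y and x by [det_rank1_change_row]. *)
Lemma cofactor_of_null_vectors (F : fieldType) m (A : 'M[F]_m) (k : 'cV_m) (l : 'rV_m)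
    (x : 'cV_m) (y : 'rV_m) i j :
  A *m k = 0 -> l *m A = 0 -> k j 0 != 0 -> (l *m x) 0 0 != 0 -> (y *m k) 0 0 != 0 ->
  cofactor A i j * (l *m x) 0 0 * (y *m k) 0 0 = \det (A + x *m y) * l 0 i * k j 0.
Proof.
move=> Ak lA kj lx yk.
have detA : \det A = 0.
  apply/eqP; apply: contraNT kj => nz.
  have uA : A \in unitmx by rewrite unitmxE unitfE.
  by rewrite -[k](mulKmx uA) Ak mulmx0 mxE.
have -> : cofactor A i j = \det (A + delta_mx i (0 : 'I_1) *m delta_mx 0 j).
  rewrite mul_delta_mx (expand_det_row _ i).
  transitivity (\sum_j0 (A i j0 * cofactor A i j0 + (j0 == j)%:R * cofactor A i j0)).
    rewrite big_split /= -expand_det_row detA add0r.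
    by rewrite (bigD1 j) //= eqxx mul1r big1 ?addr0 // => a /negPf->; rewrite mul0r.
  apply: eq_bigr => a _; rewrite -mulrDl !mxE eqxx /=; congr (_ * _).
  rewrite /cofactor; congr (_ * \det _); apply/matrixP => b c; rewrite !mxE.
  by rewrite eq_sym (negPf (neq_lift i b)) andFb addr0.
have dk : (delta_mx (0 : 'I_1) j *m k) 0 0 = k j 0 by rewrite -rowE mxE.
have dl : (l *m delta_mx i (0 : 'I_1)) 0 0 = l 0 i by rewrite -colE mxE.
rewrite mulrAC (det_rank1_change_row _ _ Ak yk) dk mulrAC; congr (_ * _).
have lAT : A^T *m l^T = 0 by rewrite -trmx_mul lA trmx0.
have := @det_rank1_change_row _ _ A^T y^T x^T (delta_mx i 0)^T l^T lAT.
by rewrite -!trmx_mul -!linearD /= !det_tr ![_^T _ _]mxE dl; apply.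
Qed.

(** * Cyclic block matrices *)

Lemma sum_enum_val (R : nmodType) (T : finType) (G : T -> R) :
  \sum_(i < #|T|) G (enum_val i) = \sum_x G x.
Proof. by rewrite [RHS](reindex _ (onW_bij _ (@enum_val_bij T))). Qed.

Lemma pair_indicator_sum (R : pzSemiRingType) (I J : finType) (i0 : I) (G : I -> J -> R) :
  \sum_(e : I * J) (e.1 == i0)%:R * G e.1 e.2 = \sum_j G i0 j.
Proof.
rewrite -(pair_big xpredT xpredT (fun i j => (i == i0)%:R * G i j)) /=.
rewrite (bigD1 i0) //= [X in _ + X]big1 ?addr0.
  by apply: eq_bigr => j _; rewrite eqxx mul1r.
by move=> i /negPf ne; rewrite big1 // => j _; rewrite ne mul0r.
Qed.

(** The matrix A has an L x L block structure with diagonal blocks diag (d k)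
   in position (k, k) and blocks N k in position (k, k - 1), cyclically; so it
   kills the sequences with v_k = B k v_(k-1).  Without the corner block N 0 it is
   lower triangular.  The corner block and the perturbation together add a
   product X Y through dimension p, and the triangular system low Z = X is solved
   by propagation from the first level: Z = (C k)_k, so that [det_add_mulmx]
   applies.  The column of the perturbation is X 1, which propagates to the
   constant column on the last level. *)
Lemma det_cyclic_blocks (R : comNzRingType) (L p : nat)
    (N : 'I_L -> 'M[R]_p) (d : 'I_L -> 'rV[R]_p) (B C : nat -> 'M[R]_p) (y : 'rV[R]_p)
    (A : 'M[R]_#|{: 'I_L * 'I_p}|) :
  (0 < L)%N ->
  (forall a b, A a b =
      ((enum_val b).1 == ord_pred (enum_val a).1)%:R
        * N (enum_val a).1 (enum_val a).2 (enum_val b).2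
      + ((enum_val b).1 == (enum_val a).1)%:R
        * diag_mx (d (enum_val a).1) (enum_val a).2 (enum_val b).2) ->
  (forall k : 'I_L, diag_mx (d k) *m B k = - N k) ->
  C 0%N = 1%:M -> (forall k, (k.+1 < L)%N -> C k.+1 = B k.+1 *m C k) ->
  C L.-1 *m const_mx 1 = const_mx 1 :> 'cV_p ->
  \det (A + \col_(a < #|{: 'I_L * 'I_p}|)
               (((enum_val a).1 == 0 :> nat)%:R * d (enum_val a).1 0 (enum_val a).2)
            *m \row_(b < #|{: 'I_L * 'I_p}|)
               (((enum_val b).1 == L.-1 :> nat)%:R * y 0 (enum_val b).2))
  = (\prod_(e : 'I_L * 'I_p) d e.1 0 e.2)
    * \det (1%:M - C L.-1 *m B 0%N + const_mx 1 *m y).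
Proof.
move=> L_gt0 defA DB C0 CS C1.
pose T : finType := ('I_L * 'I_p)%type.
pose nA (e f : T) := ((e.1 != 0 :> nat) && (f.1 == ord_pred e.1))%:R * N e.1 e.2 f.2 : R.
pose dA (e f : T) := (f.1 == e.1)%:R * diag_mx (d e.1) e.2 f.2 : R.
pose low : 'M[R]_#|T| := \matrix_(a < #|T|, b < #|T|)
  (nA (enum_val a) (enum_val b) + dA (enum_val a) (enum_val b)).
pose X : 'M[R]_(#|T|, p) := \matrix_(a < #|T|, j < p)
  (((enum_val a).1 == 0 :> nat)%:R * diag_mx (d (enum_val a).1) (enum_val a).2 j).
pose Z : 'M[R]_(#|T|, p) := \matrix_(a < #|T|, j < p) C (enum_val a).1 (enum_val a).2 j.
pose Y : 'M[R]_(p, #|T|) := \matrix_(i < p, b < #|T|)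
  (((enum_val b).1 == L.-1 :> nat)%:R * (- B 0%N + const_mx 1 *m y) i (enum_val b).2).
have lowZ : low *m Z = X.
  apply/matrixP => a j; rewrite !mxE; set e := enum_val a.
  transitivity (\sum_(f : T) (nA e f + dA e f) * C f.1 f.2 j).
    by rewrite -[RHS]sum_enum_val; apply: eq_bigr => b _; rewrite !mxE.
  under eq_bigr => f _ do rewrite mulrDl /nA /dA -mulrA -[X in _ + X]mulrA.
  rewrite big_split /=.
  rewrite (@pair_indicator_sum _ _ _ e.1 (fun k i => diag_mx (d e.1) e.2 i * C k i j)).
  case: (eqVneq (e.1 : nat) 0%N) => [e0|e0] /=.
    rewrite big1 ?add0r; last by move=> f _; rewrite mul0r.
    transitivity ((diag_mx (d e.1) *m C e.1) e.2 j); first by rewrite mxE.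
    by rewrite e0 C0 mulmx1 mul1r mxE.
  rewrite mul0r (@pair_indicator_sum _ _ _ (ord_pred e.1) (fun k i => N e.1 e.2 i * C k i j)).
  have -> : nat_of_ord (ord_pred e.1) = (e.1 : nat).-1.
    have := ltn_ord e.1; rewrite /=; move: e0; case: (nat_of_ord e.1) => // k _ kL.
    by rewrite addSn /= modnDr modn_small // ltnW.
  have -> : C e.1 = B e.1 *m C (e.1 : nat).-1.
    by move: e0 (ltn_ord e.1); case: (nat_of_ord e.1) => // k _ /CS.
  have := congr1 (fun M : 'M_p => (M *m C (e.1 : nat).-1) e.2 j) (DB e.1).
  rewrite -mulmxA mulNmx mxE [X in _ = X]mxE => ->.
  by rewrite mxE subrr.
have -> : A + \col_(a < #|{: 'I_L * 'I_p}|)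
               (((enum_val a).1 == 0 :> nat)%:R * d (enum_val a).1 0 (enum_val a).2)
            *m \row_(b < #|{: 'I_L * 'I_p}|)
               (((enum_val b).1 == L.-1 :> nat)%:R * y 0 (enum_val b).2)
   = low + X *m Y.
  apply/matrixP => a b; rewrite !mxE defA big_ord1 !mxE.
  set e := enum_val a; set f := enum_val b.
  have -> : \sum_j X a j * Y j b
      = (e.1 == 0 :> nat)%:R * (f.1 == L.-1 :> nat)%:R * (N e.1 e.2 f.2 + d e.1 0 e.2 * y 0 f.2).
    rewrite (bigD1 e.2) //= [X in _ + X]big1 ?addr0.
      rewrite !mxE -/e -/f eqxx mulr1n big_ord1 !mxE mul1r.
      have := congr1 (fun M : 'M_p => M e.2 f.2) (DB e.1).
      rewrite mul_diag_mx !mxE.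
      case: (eqVneq (e.1 : nat) 0%N) => [->|_] h; rewrite ?mul0r //.
      rewrite -[N _ _ _]opprK -h; ring.
    by move=> i ne; rewrite !mxE -/e [e.2 == _]eq_sym (negPf ne) mulr0n mulr0 mul0r.
  rewrite /nA /dA.
  have -> : (f.1 == ord_pred e.1)
      = if (e.1 == 0 :> nat) then (f.1 == L.-1 :> nat) else (f.1 == ord_pred e.1).
    case: (eqVneq (e.1 : nat) 0%N) => [e0|//]; rewrite -val_eqE /= e0 add0n modn_small //; lia.
  rewrite [diag_mx _ _ _]mxE; case: (e.1 == 0 :> nat) => /=; ring.
rewrite (det_add_mulmx _ lowZ); congr (_ * _).
  rewrite (@det_ranked_triangular _ _ _ (fun a : 'I_#|T| => (enum_val a).1)).
    rewrite (eq_bigr (fun a => (fun e : T => d e.1 0 e.2) (enum_val a))).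
      by rewrite [RHS](reindex _ (onW_bij _ (@enum_val_bij T))) /=.
    move=> a _; rewrite !mxE /nA /dA !eqxx /= mul1r mxE eqxx mulr1n.
    have -> : (nat_of_ord (enum_val a).1 != 0%N)
        && ((enum_val a).1 == ord_pred (enum_val a).1) = false.
      apply/negP => /andP[nz /eqP /(congr1 val) /= h].
      move: h; have := ltn_ord (enum_val a).1; move: nz.
      case: (nat_of_ord (enum_val a).1) => // k _ kL; rewrite addSn /= modnDr modn_small; lia.
    by rewrite mul0r add0r.
  move=> a b; rewrite !mxE /nA /dA; set e := enum_val a; set f := enum_val b => nz ab.
  case: (boolP ((nat_of_ord e.1 != 0%N) && (f.1 == ord_pred e.1))) nz => [/andP[nz /eqP->] _|_].
    move: nz; have := ltn_ord e.1 => /=.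
    case: (nat_of_ord e.1) => // k kL _; rewrite addSn /= modnDr modn_small; lia.
  rewrite mul0r add0r; case: (eqVneq f.1 e.1) => [e1|]; last by rewrite mul0r eqxx.
  rewrite mul1r mxE; case: (eqVneq e.2 f.2) => [e2|]; last by rewrite eqxx.
  case/eqP: ab; apply: enum_val_inj; rewrite -/e -/f.
  by move: e1 e2; case: (e) (f) => [? ?] [? ?] /= -> ->.
have -> : Y *m Z = (- B 0%N + const_mx 1 *m y) *m C L.-1.
  apply/matrixP => i j; rewrite !mxE.
  have lP : (L.-1 < L)%N by lia.
  transitivity (\sum_(f : T) (f.1 == Ordinal lP)%:R
                  * ((- B 0%N + const_mx 1 *m y) i f.2 * C f.1 f.2 j)).
    by rewrite -[RHS]sum_enum_val; apply: eq_bigr => b _; rewrite [Y _ _]mxE [Z _ _]mxE -mulrA.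
  by rewrite (@pair_indicator_sum _ _ _ (Ordinal lP)
                (fun k l => (- B 0%N + const_mx 1 *m y) i l * C k l j)).
by rewrite det_add1_mulmxC mulmxDr mulmxN mulmxA C1 addrA.
Qed.

(** * Burau matrices of braid words *)

Definition goes_under p (x : 'I_p.-1 * bool) (i : 'I_p) : bool :=
  (i : nat) == (if x.2 then x.1 : nat else x.1.+1).

Lemma val_swap_adjacent p (g : 'I_p.-1) (i : 'I_p) :
  swap_adjacent g i =
    (if (i : nat) == g then g.+1 else if (i : nat) == g.+1 then g : nat else i) :> nat.
Proof.
rewrite /swap_adjacent val_insubd; case: ifP => // /negP[].
by have := ltn_ord g; have := ltn_ord i; rewrite /=; do 2?case: eqP => /=; lia.
Qed.

Lemma swap_adjacentK p (g : 'I_p.-1) : involutive (swap_adjacent g).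
Proof.
move=> i; apply: val_inj => /=; rewrite !val_swap_adjacent.
move: (nat_of_ord i) (nat_of_ord g) => a b.
case: (eqVneq a b) => [->|ab]; first by rewrite eqxx gtn_eqF.
case: (eqVneq a b.+1) => [->|ab1]; first by rewrite eqxx.
by rewrite (negPf ab) (negPf ab1).
Qed.

Section Burau.

Variables (F : fieldType) (t : F) (p : nat).

(** The rows of the Alexander matrix that belong to the letter x read
   diag (outgoing_coef) v_k + incoming_mx v_(k-1), for the vector v_k of the edges
   above the letter and the vector v_(k-1) of those below it. *)
Definition outgoing_coef (x : 'I_p.-1 * bool) (i : 'I_p) : F :=
  if x.2 && goes_under x i then t else -1.

Definition swap_coef (x : 'I_p.-1 * bool) (i : 'I_p) : F :=
  if goes_under x i then (if x.2 then -1 else t) else 1.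

Definition incoming_mx (x : 'I_p.-1 * bool) : 'M[F]_p :=
  \matrix_(i, j) ((j == i)%:R * (goes_under x i)%:R * (1 - t)
                  + (j == swap_adjacent x.1 i)%:R * swap_coef x i).

(** The solution v_k = burau_letter v_(k-1) of these rows; it needs division by t
   at a positive letter, hence a field. *)
Definition burau_letter (x : 'I_p.-1 * bool) : 'M[F]_p :=
  \matrix_(i, j) (- (outgoing_coef x i)^-1 * incoming_mx x i j).

(** Strands run upwards, so the last letter acts last and stands on the left. *)
Definition burau (w : braid_word p) : 'M[F]_p :=
  foldl (fun M x => burau_letter x *m M) 1%:M w.

Lemma burau_cat w1 w2 : burau (w1 ++ w2) = burau w2 *m burau w1.
Proof.
rewrite /burau foldl_cat; elim/last_ind: w2 => [|w2 x IH] /=; first by rewrite mul1mx.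
by rewrite -!cats1 !foldl_cat /= IH mulmxA.
Qed.

Lemma burau_rcons w x : burau (rcons w x) = burau_letter x *m burau w.
Proof. by rewrite /burau -cats1 foldl_cat. Qed.

Lemma burau_cons w x : burau (x :: w) = burau w *m burau_letter x.
Proof. by rewrite -cat1s burau_cat /burau /= mulmx1. Qed.

(** Columns are written as functions on nat, so that the shifts of strands become
   plain arithmetic on indices. *)
Definition vec (f : nat -> F) : 'cV[F]_p := \col_(i < p) f i.

Lemma incoming_mx_vec x f i :
  (incoming_mx x *m vec f) i 0 =
    (goes_under x i)%:R * (1 - t) * f i + swap_coef x i * f (swap_adjacent x.1 i).
Proof.
rewrite mxE; under eq_bigr => j _ do rewrite !mxE mulrDl.
rewrite big_split /= (bigD1 i) //= [X in _ + X + _]big1 ?addr0; last first.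
  by move=> j /negPf->; rewrite !mul0r.
rewrite (bigD1 (swap_adjacent x.1 i)) //= [X in _ + (_ + X)]big1 ?addr0; last first.
  by move=> j /negPf->; rewrite !mul0r.
by rewrite !eqxx !mul1r.
Qed.

Lemma eq_vec f g : (forall i, (i < p)%N -> f i = g i) -> vec f = vec g.
Proof. by move=> e; apply/colP => i; rewrite !mxE e. Qed.

Lemma eq_mx_on_vec (A B : 'M[F]_p) : (forall f, A *m vec f = B *m vec f) -> A = B.
Proof.
move=> e; apply/matrixP => i j.
have eqd : vec (fun k => (k == j)%:R) = delta_mx j 0.
  by apply/colP => k; rewrite !mxE andbT.
by have := e (fun k => (k == j)%:R); rewrite eqd -!colE => /colP/(_ i); rewrite !mxE.
Qed.

Lemma incoming_mx_1 x i :
  (incoming_mx x *m const_mx 1 : 'cV_p) i 0 + outgoing_coef x i = 0.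
Proof.
have -> : const_mx 1 = vec (fun=> 1) by apply/colP => j; rewrite !mxE.
rewrite incoming_mx_vec /outgoing_coef /swap_coef.
by case: (goes_under x i); case: x => g [] /=; ring.
Qed.

(** The row (t^(p-1), ..., t, 1) is preserved by all Burau matrices: up to a unit,
   it is the Fox gradient of the product of the meridians, which a braid fixes.
   These are the coefficients that it forces on the rows of a letter; the
   exceptional row makes up for its outgoing coefficient t instead of -1. *)
Definition wirtinger_weight (x : 'I_p.-1 * bool) (i : 'I_p) : F :=
  if x.2 && goes_under x i then - t ^+ (p - i.+2) else t ^+ (p - i.+1).

Lemma weight_outgoing_coef x i :
  wirtinger_weight x i * outgoing_coef x i = - t ^+ (p - i.+1).
Proof.
rewrite /wirtinger_weight /outgoing_coef /goes_under.
case: x => g [] /=; last by rewrite mulrN1.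
case: eqP => [ig|_]; last by rewrite mulrN1.
rewrite mulNr -exprSr; congr (- t ^+ _); have := ltn_ord g; lia.
Qed.

Lemma sum_weight_incoming_mx x j :
  \sum_i wirtinger_weight x i * incoming_mx x i j = t ^+ (p - j.+1).
Proof.
under eq_bigr => i _ do rewrite mxE mulrDr.
rewrite big_split /= (bigD1 j) //= [X in _ + X + _]big1 ?addr0; last first.
  by move=> i ne; rewrite eq_sym (negPf ne) !mul0r mulr0.
rewrite (bigD1 (swap_adjacent x.1 j)) //= [X in _ + (_ + X)]big1 ?addr0; last first.
  move=> i ne; case: eqP => [e|]; last by rewrite mul0r mulr0.
  by case/eqP: ne; rewrite e swap_adjacentK.
rewrite swap_adjacentK !eqxx !mul1r.
case: x => g b; rewrite /wirtinger_weight /swap_coef /goes_under /= val_swap_adjacent.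
have gp := ltn_ord g; have jp := ltn_ord j.
move: (nat_of_ord g) (nat_of_ord j) gp jp => a c ap cp.
have e1 : (p - a.+1 = (p - a.+2).+1)%N by lia.
have eqS := (gtn_eqF (ltnSn a), ltn_eqF (ltnSn a)).
case: (eqVneq c a) => [->|ca].
  by case: b; rewrite /= ?eqS ?eqxx ?e1 ?exprS /=; ring.
case: (eqVneq c a.+1) => [->|ca1].
  by case: b; rewrite /= ?eqS ?eqxx ?e1 ?exprS /=; ring.
by case: b; rewrite /= ?(negPf ca) ?(negPf ca1) /=; ring.
Qed.

Hypothesis t_neq0 : t != 0.

Lemma outgoing_coef_neq0 x i : outgoing_coef x i != 0.
Proof. by rewrite /outgoing_coef; case: ifP => // _; rewrite oppr_eq0 oner_eq0. Qed.

Lemma diag_burau_letter x :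
  diag_mx (\row_i outgoing_coef x i) *m burau_letter x = - incoming_mx x.
Proof.
apply/matrixP => i j; rewrite mul_diag_mx !mxE.
by rewrite mulrA mulrN mulfV ?outgoing_coef_neq0 // mulN1r.
Qed.

Lemma burau_letter_1 x : burau_letter x *m const_mx 1 = const_mx 1 :> 'cV_p.
Proof.
apply/colP => i; have := incoming_mx_1 x i; rewrite !mxE.
under [X in _ -> X = _]eq_bigr => j _ do rewrite mxE -mulrA.
rewrite -mulr_sumr => /eqP; rewrite addr_eq0 => /eqP ->.
by rewrite mulrNN mulVf // outgoing_coef_neq0.
Qed.

Lemma burau_1 w : burau w *m const_mx 1 = const_mx 1 :> 'cV_p.
Proof.
elim/last_ind: w => [|w x IH]; first by rewrite mul1mx.
by rewrite burau_rcons -mulmxA IH burau_letter_1.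
Qed.

End Burau.

(** * Units of the Laurent polynomial ring *)

Section MonomialUnits.

Variables (F : fieldType) (t : F).
Hypothesis t_neq0 : t != 0.

(** The units +/- t^k for k in Z, encoded without negative exponents. *)
Definition monomial_unit (u : F) : Prop :=
  exists (m n : nat) (c : bool), t ^+ m * u = (-1) ^+ c * t ^+ n.

Lemma monomial_unit1 : monomial_unit 1.
Proof. by exists 0%N, 0%N, false; rewrite !expr0. Qed.

Lemma monomial_unitN1 : monomial_unit (-1).
Proof. by exists 0%N, 0%N, true; rewrite !expr0 mul1r mulr1. Qed.

Lemma monomial_unit_t : monomial_unit t.
Proof. by exists 0%N, 1%N, false; rewrite !expr0 !mul1r. Qed.

Lemma monomial_unitM u v : monomial_unit u -> monomial_unit v -> monomial_unit (u * v).
Proof.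
move=> [m [n [c e]]] [m' [n' [c' e']]]; exists (m + m')%N, (n + n')%N, (c (+) c').
by rewrite !exprD signr_addb mulrACA e e' mulrACA.
Qed.

Lemma monomial_unit_neq0 u : monomial_unit u -> u != 0.
Proof.
move=> [m [n [c e]]]; apply: contra_eq_neq e => ->.
by rewrite mulr0 eq_sym mulf_neq0 // ?signr_eq0 ?expf_neq0.
Qed.

Lemma monomial_unitV u : monomial_unit u -> monomial_unit u^-1.
Proof.
move=> uu; have nz := monomial_unit_neq0 uu; case: uu => [m [n [c e]]].
exists n, m, c; apply: (mulIf nz); rewrite mulfVK // -mulrA e mulrA -signr_addb addbb.
by rewrite mul1r.
Qed.

Lemma monomial_unitX u k : monomial_unit u -> monomial_unit (u ^+ k).
Proof.
move=> uu; elim: k => [|k IH]; first exact: monomial_unit1.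
by rewrite exprS; apply: monomial_unitM.
Qed.

Lemma monomial_unit_prod (I : finType) (G : I -> F) :
  (forall i, monomial_unit (G i)) -> monomial_unit (\prod_i G i).
Proof. by move=> h; elim/big_ind: _; [exact: monomial_unit1|exact: monomial_unitM|]. Qed.

End MonomialUnits.

(** * Minors of the Alexander matrix of a closed braid *)

Section ClosedBraid.

Variables (F : fieldType) (phi : {rmorphism {poly int} -> F}) (p : nat).
Let t := phi 'X.
Hypothesis t_neq0 : t != 0.
Variable w : braid_word p.
Let L := size w.
Hypothesis w_gt0 : (0 < L)%N.
Let letter (k : 'I_L) := tnth (in_tuple w) k.
Let A := map_mx phi (alexander_matrix (closed_braid w)).

Lemma alexander_matrix_closed_braid (a b : 'I_#|{: 'I_L * 'I_p}|) :
  A a b = ((enum_val b).1 == ord_pred (enum_val a).1)%:R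
            * incoming_mx t (letter (enum_val a).1) (enum_val a).2 (enum_val b).2
      + ((enum_val b).1 == (enum_val a).1)%:R
        * diag_mx (\row_i outgoing_coef t (letter (enum_val a).1) i)
            (enum_val a).2 (enum_val b).2.
Proof.
rewrite !mxE; move: (enum_val a) (enum_val b) => [k i] [l j] /=.
rewrite /alexander_entry /= -/(letter k) -[_ == (if _ then _ else _)]/(goes_under (letter k) i).
rewrite /outgoing_coef /swap_coef.
case: (letter k) => g b' /=; case: (goes_under _ i); case: b' => /=.
all: rewrite ?rmorphD ?rmorphB ?rmorphN ?rmorphM ?rmorphB ?rmorph1 ?rmorph_nat -/t.
all: rewrite !xpair_eqE -!mulnb !natrM -[_ *+ (i == j)]mulr_natr (eq_sym i j).
- have key (c1 c2 c3 c4 : F) : (1 - t) * (c1 * c3) + t * (c2 * c3) - c1 * c4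
    = c1 * (c3 * 1 * (1 - t) + c4 * -1) + c2 * (t * c3) by ring.
  exact: key.
- have key (c1 c2 c3 c4 : F) : (1 - t) * (c1 * c3) + t * (c1 * c4) - c2 * c3
    = c1 * (c3 * 1 * (1 - t) + c4 * t) + c2 * (-1 * c3) by ring.
  exact: key.
- have key (c1 c2 c3 c4 : F) : c1 * c4 - c2 * c3
    = c1 * (c3 * 0 * (1 - t) + c4 * 1) + c2 * (-1 * c3) by ring.
  exact: key.
have key (c1 c2 c3 c4 : F) : c1 * c4 - c2 * c3
    = c1 * (c3 * 0 * (1 - t) + c4 * 1) + c2 * (-1 * c3) by ring.
exact: key.
Qed.

Let onesL : 'cV[F]_#|{: 'I_L * 'I_p}| := const_mx 1.
Let weights : 'rV[F]_#|{: 'I_L * 'I_p}| :=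
  \row_a wirtinger_weight t (letter (enum_val a).1) (enum_val a).2.

Lemma alexander_matrix_mul_ones : A *m onesL = 0.
Proof.
apply/colP => a; rewrite !mxE; set e := enum_val a.
transitivity (\sum_(f : 'I_L * 'I_p)
  ((f.1 == ord_pred e.1)%:R * incoming_mx t (letter e.1) e.2 f.2
   + (f.1 == e.1)%:R * diag_mx (\row_i outgoing_coef t (letter e.1) i) e.2 f.2)).
  rewrite -[RHS]sum_enum_val; apply: eq_bigr => b _.
  by rewrite alexander_matrix_closed_braid [onesL _ _]mxE mulr1.
rewrite big_split /= (pair_indicator_sum _ (fun k j => incoming_mx t (letter e.1) e.2 j)).
rewrite (pair_indicator_sum _ (fun k j => diag_mx (\row_i outgoing_coef t (letter e.1) i) e.2 j)).
rewrite [X in _ + X](bigD1 e.2) //= [X in _ + (_ + X)]big1 ?addr0; last first.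
  by move=> j ne; rewrite mxE eq_sym (negPf ne).
rewrite !mxE eqxx mulr1n -[RHS](incoming_mx_1 t (letter e.1) e.2); congr (_ + _).
by rewrite mxE; apply: eq_bigr => j _; rewrite [const_mx _ _ _]mxE mulr1.
Qed.

Lemma weights_mul_alexander_matrix : weights *m A = 0.
Proof.
apply/rowP => b; rewrite !mxE; set f := enum_val b.
transitivity (\sum_(e : 'I_L * 'I_p)
   ((e.1 == ordS f.1)%:R
      * (wirtinger_weight t (letter e.1) e.2 * incoming_mx t (letter e.1) e.2 f.2)
   + (e.1 == f.1)%:R
      * (wirtinger_weight t (letter e.1) e.2
         * diag_mx (\row_i outgoing_coef t (letter e.1) i) e.2 f.2))).
  rewrite -[RHS]sum_enum_val; apply: eq_bigr => a _.
  rewrite alexander_matrix_closed_braid mxE -/f; set e := enum_val a.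
  have -> : (f.1 == ord_pred e.1) = (e.1 == ordS f.1).
    by rewrite -(can_eq (@ordSK _)) ord_predK eq_sym.
  by rewrite [f.1 == _]eq_sym; ring.
rewrite big_split /= (pair_indicator_sum _
  (fun k i => wirtinger_weight t (letter k) i * incoming_mx t (letter k) i f.2)).
rewrite (pair_indicator_sum _ (fun k i => wirtinger_weight t (letter k) i
  * diag_mx (\row_i outgoing_coef t (letter k) i) i f.2)).
rewrite sum_weight_incoming_mx // (bigD1 f.2) //= [X in _ + (_ + X)]big1 ?addr0; last first.
  by move=> i ne; rewrite mxE (negPf ne) mulr0.
by rewrite !mxE eqxx mulr1n weight_outgoing_coef // addrN.
Qed.

(** The row y is left free: it will absorb the part of the Burau matrix of a torus
   braid that has equal rows. *)
Lemma closed_braid_minor i j (y : 'rV[F]_p) :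
  \sum_(k < p) t ^+ k != 0 -> (y *m const_mx 1 : 'cV_1) 0 0 != 0 ->
  exists2 u, monomial_unit t u &
    phi (\det (row' i (col' j (alexander_matrix (closed_braid w)))))
      * (\sum_(k < p) t ^+ k) * (y *m const_mx 1 : 'cV_1) 0 0
    = u * \det (1%:M - burau t w + const_mx 1 *m y).
Proof.
move=> sum_neq0 y_neq0.
pose d (k : 'I_L) : 'rV_p := \row_i outgoing_coef t (letter k) i.
pose x : 'cV[F]__ := \col_(a < #|{: 'I_L * 'I_p}|)
  (((enum_val a).1 == 0 :> nat)%:R * d (enum_val a).1 0 (enum_val a).2).
pose z : 'rV[F]__ := \row_(b < #|{: 'I_L * 'I_p}|)
  (((enum_val b).1 == L.-1 :> nat)%:R * y 0 (enum_val b).2).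
have lP : (L.-1 < L)%N by rewrite prednK.
have lx : (weights *m x) 0 0 = - \sum_(k < p) t ^+ k.
  rewrite mxE; transitivity (\sum_(e : 'I_L * 'I_p) (e.1 == Ordinal w_gt0)%:R *
     (wirtinger_weight t (letter e.1) e.2 * outgoing_coef t (letter e.1) e.2)).
    by rewrite -[RHS]sum_enum_val; apply: eq_bigr => a _; rewrite !mxE mulrCA.
  rewrite (pair_indicator_sum _
    (fun k i => wirtinger_weight t (letter k) i * outgoing_coef t (letter k) i)).
  under eq_bigr => k _ do rewrite weight_outgoing_coef.
  by rewrite sumrN [in RHS](reindex_inj rev_ord_inj).
have zk : (z *m onesL) 0 0 = (y *m const_mx 1 : 'cV_1) 0 0.
  rewrite mxE; transitivity (\sum_(e : 'I_L * 'I_p) (e.1 == Ordinal lP)%:R * y 0 e.2).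
    by rewrite -[RHS]sum_enum_val; apply: eq_bigr => a _; rewrite !mxE mulr1.
  rewrite (pair_indicator_sum _ (fun k i => y 0 i)) mxE.
  by apply: eq_bigr => k _; rewrite mxE mulr1.
have := @cofactor_of_null_vectors _ _ A onesL weights x z i j
   alexander_matrix_mul_ones weights_mul_alexander_matrix.
rewrite lx zk [onesL _ _]mxE oner_eq0 oppr_eq0 => /(_ isT sum_neq0 y_neq0).
have -> : \det (A + x *m z) = (\prod_(e : 'I_L * 'I_p) d e.1 0 e.2)
    * \det (1%:M - burau t w + const_mx 1 *m y).
  have [x0 [w' def_w]] : exists x0 w', w = x0 :: w'.
    by move: w_gt0; rewrite /L; case: (w) => // x0 w' _; exists x0, w'.
  have defL : L = (size w').+1 by rewrite /L def_w.
  rewrite (@det_cyclic_blocks _ L p (fun k => incoming_mx t (letter k)) d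
    (fun k => burau_letter t (nth x0 w k)) (fun k => burau t (take k w')) y A w_gt0) //.
  - congr (_ * \det (_ - _ + _)).
    by rewrite [in RHS]def_w burau_cons (_ : L.-1 = size w') ?defL // take_size {1}def_w.
  - exact: alexander_matrix_closed_braid.
  - by move=> k; rewrite -diag_burau_letter // /d /letter (tnth_nth x0).
  - by rewrite take0.
  - by move=> k; rewrite defL ltnS => kw; rewrite def_w /= -burau_rcons -take_nth.
  - exact: burau_1.
set D := \prod_e _; set B := \det (1%:M - _ + _).
have uD : monomial_unit t D.
  apply: monomial_unit_prod => e; rewrite mxE /outgoing_coef.
  by case: ifP => _; [exact: monomial_unit_t|exact: monomial_unitN1].
have uW : monomial_unit t (weights 0 i).
  rewrite mxE /wirtinger_weight; case: ifP => _; last first.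
    exact/monomial_unitX/monomial_unit_t.
  rewrite -mulN1r; apply: monomial_unitM (monomial_unitN1 _) _.
  exact/monomial_unitX/monomial_unit_t.
have uS : monomial_unit t ((-1) ^+ (i + j)) by apply/monomial_unitX/monomial_unitN1.
rewrite /cofactor -map_col' -map_row' det_map_mx mulr1 => eqn.
exists ((-1) ^+ (i + j) * (-1) * (D * weights 0 i)).
  by do ?apply: monomial_unitM => //; apply: monomial_unitN1.
have sg : (-1) ^+ (i + j) * (-1) ^+ (i + j) = 1 :> F by rewrite -expr2 sqrr_sign.
move: eqn sg; clear uD uW uS.
move: ((-1) ^+ (i + j)) (phi _) (\sum_(k < p) _) ((y *m _) 0 0) D B (weights 0 i).
clear => s m S Y D B W eqn sg.
transitivity (s * s * (m * S * Y)); first by rewrite sg mul1r.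
transitivity (- s * (s * m * - S * Y)); first by ring.
by rewrite eqn; ring.
Qed.

End ClosedBraid.

(** * Burau matrices of torus braids and of full twists *)

Section Chains.

Variables (F : fieldType) (t : F) (p : nat).
Local Notation vec := (@vec F p).
Local Notation burau_letter := (@burau_letter F t p).
Local Notation burau := (@burau F t p).

Definition eval_row (k : nat) : 'rV[F]_p := \row_(j < p) (j == k :> nat)%:R.

Lemma eval_row_vec k f : (k < p)%N -> eval_row k *m vec f = (f k)%:M.
Proof.
move=> kp; rewrite [LHS]mx11_scalar mxE (bigD1 (Ordinal kp)) //= big1.
  by rewrite !mxE eqxx mul1r addr0.
by move=> j ne; rewrite !mxE -[_ == k]/(j == Ordinal kp) (negPf ne) mul0r.
Qed.

Lemma burau_letter_vec x f i :
  (burau_letter x *m vec f) i 0 = - (outgoing_coef t x i)^-1 *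
    ((goes_under x i)%:R * (1 - t) * f i + swap_coef t x i * f (swap_adjacent x.1 i)).
Proof.
rewrite -incoming_mx_vec !mxE mulr_sumr; apply: eq_bigr => j _.
by rewrite [burau_letter _ _ _]mxE mulrA.
Qed.

Lemma burau_negative_letter (g : 'I_p.-1) f :
  burau_letter (g, false) *m vec f =
  vec (fun i => if i == g then f g.+1
                else if i == g.+1 then t * f g + (1 - t) * f g.+1 else f i).
Proof.
apply/colP => i; rewrite burau_letter_vec mxE /outgoing_coef /swap_coef /goes_under /=.
rewrite val_swap_adjacent invrN invr1 opprK mul1r.
case: (eqVneq (i : nat) g) => [->|ig]; first by rewrite ltn_eqF // !mul0r add0r mul1r.
case: (eqVneq (i : nat) g.+1) => [->|ig1]; first by rewrite /= mul1r addrC.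
by rewrite /= !mul0r add0r mul1r.
Qed.

Lemma burau_flatten_nseq m w : burau (flatten (nseq m w)) = burau w ^+ m.
Proof. by elim: m => [//|m IH]; rewrite /= burau_cat IH exprSr. Qed.

(** In the inverse of a chain the strand at position a + l passes over all the others
   to position a, and each of them moves up by one place. *)
Lemma burau_inverse_chain (gs : seq 'I_p.-1) a l f :
  [seq val g | g <- gs] = iota a l -> (a + l < p)%N ->
  burau (braid_inv [seq (g, true) | g <- gs]) *m vec f =
  vec (fun i => if (a <= i <= a + l)%N
                then if i == a then f (a + l)%N else t * f i.-1 + (1 - t) * f (a + l)%N
                else f i).
Proof.
elim: gs a l => [|g gs IH] a [|l] //=.
  move=> _ _; rewrite mul1mx; apply: eq_vec => i _; rewrite addn0.
  by case: ifP => //; case: eqP => [->//|]; lia.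
case=> ga gsl alp; rewrite /braid_inv /= rev_cons burau_rcons -mulmxA.
rewrite -/(braid_inv [seq (g, true) | g <- gs]) (IH _ _ gsl); last by lia.
have {}ga : nat_of_ord g = a := ga.
rewrite burau_negative_letter ga; apply: eq_vec => i _.
have -> : (a < a.+1 <= a.+1 + l)%N = true by lia.
have -> : (a < a <= a.+1 + l)%N = false by lia.
have -> : (a.+1 + l = a + l.+1)%N by lia.
rewrite eqxx; case: (eqVneq i a) => [->|ia]; first by rewrite leqnn leq_addr.
case: (eqVneq i a.+1) => [->|ia1] /=; first by rewrite (_ : (a <= a.+1 <= a + l.+1)%N) //; lia.
by have -> : (a < i)%N = (a <= i)%N by lia.
Qed.

Lemma inverse_chain_vec r f : (0 < r <= p)%N ->
  burau (braid_inv (sigma_chain p r)) *m vec f =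
  vec (fun i => if (i < r)%N
                then if i == 0%N then f r.-1 else t * f i.-1 + (1 - t) * f r.-1
                else f i).
Proof.
case/andP=> r_gt0 rp.
have gsE : [seq val g | g <- [seq g : 'I_p.-1 <- enum 'I_p.-1 | (g < r.-1)%N]] = iota 0 r.-1.
  rewrite -(filter_map val (fun k => k < r.-1)%N) val_enum_ord.
  by rewrite -[r.-1]add0n filter_iota_ltn //; lia.
rewrite (burau_inverse_chain _ gsE); last by lia.
by apply: eq_vec => i _; rewrite add0n leq0n /= -ltnS prednK.
Qed.

(** Each application shifts the r strands cyclically and adds a multiple of the
   value on the last one; this multiple is the same for all of them. *)
Lemma inverse_chain_exp_vec r m f : (0 < r <= p)%N -> (m <= r)%N ->
  burau (braid_inv (sigma_chain p r)) ^+ m *m vec f =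
  vec (fun i => if (i < r)%N
                then t ^+ m * f (if (m <= i)%N then i - m else i + r - m)%N
                     + (1 - t) * \sum_(k < m) t ^+ k * f (r.-1 - k)%N
                else f i).
Proof.
move=> rp; elim: m => [_|m IH mr].
  rewrite mul1mx; apply: eq_vec => i _; case: ifP => // _.
  by rewrite big_ord0 leq0n subn0 mulr0 addr0 mul1r.
rewrite exprS -[_ * _]/(_ *m _) -mulmxA IH 1?ltnW // inverse_chain_vec //.
apply: eq_vec => i ip; case: ifP => ir; last by rewrite ir.
have [r1 r2 r3] : [/\ (r.-1 < r)%N, (i.-1 < r)%N & (m <= r.-1)%N] by split; lia.
rewrite r1 r2 r3 big_ord_recr /=; case: eqP => [->|i0].
  rewrite ltn0 (_ : 0 + r - m.+1 = r.-1 - m)%N; last by lia.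
  rewrite exprS; ring.
have -> : (if (m <= i.-1)%N then i.-1 - m else i.-1 + r - m)%N
   = (if (m < i)%N then i - m.+1 else i + r - m.+1)%N by do 2?case: ifP; lia.
rewrite exprS; ring.
Qed.

(** The row whose multiples are added by m applications of the inverse chain on
   r strands; for m = r they amount to an inverse full twist. *)
Definition twist_row m r : 'rV[F]_p :=
  (1 - t) *: \sum_(k < m) t ^+ k *: eval_row (r.-1 - k)%N.

Definition rotation_mx m : 'M[F]_p :=
  \matrix_(i, j) (t ^+ m * (j == (if (m <= i)%N then i - m else i + p - m)%N :> nat)%:R).

Definition scaling_mx r : 'M[F]_p := diag_mx (\row_i (if (i < r)%N then t ^+ r else 1)).

Definition first_strands r : 'cV[F]_p := vec (fun i => (i < r)%N%:R).

Lemma twist_row_vec m r f : (m <= r <= p)%N ->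
  twist_row m r *m vec f = ((1 - t) * \sum_(k < m) t ^+ k * f (r.-1 - k)%N)%:M.
Proof.
case/andP=> mr rp; rewrite /twist_row -scalemxAl mulmx_suml -scale_scalar_mx rmorph_sum /=.
congr (_ *: _); apply: eq_bigr => k _.
have kp : (r.-1 - k < p)%N by have := ltn_ord k; lia.
by rewrite -scalemxAl (eval_row_vec _ kp) scale_scalar_mx.
Qed.

Lemma rotation_mx_vec m f : (m <= p)%N ->
  rotation_mx m *m vec f = vec (fun i => t ^+ m * f (if (m <= i)%N then i - m else i + p - m)%N).
Proof.
move=> mp; apply/colP => i; rewrite !mxE.
have jP : ((if (m <= i)%N then i - m else i + p - m) < p)%N by have := ltn_ord i; case: ifP; lia.
rewrite (bigD1 (Ordinal jP)) //= big1 ?addr0; last first.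
  by move=> j ne; rewrite !mxE -[_ == _ :> nat]/(j == Ordinal jP) (negPf ne) mulr0 mul0r.
by rewrite !mxE eqxx mulr1.
Qed.

Lemma scaling_mx_vec r f :
  scaling_mx r *m vec f = vec (fun i => (if (i < r)%N then t ^+ r else 1) * f i).
Proof. by apply/colP => i; rewrite mul_diag_mx !mxE. Qed.

Lemma inverse_chain_exp m : (0 < p)%N -> (m <= p)%N ->
  burau (braid_inv (sigma_chain p p)) ^+ m = rotation_mx m + const_mx 1 *m twist_row m p.
Proof.
move=> p_gt0 mp; apply: eq_mx_on_vec => f.
rewrite inverse_chain_exp_vec ?p_gt0 ?leqnn // mulmxDl rotation_mx_vec // -mulmxA.
rewrite twist_row_vec ?mp ?leqnn // mul_mx_scalar; apply/colP => i.
by rewrite !mxE ltn_ord mulr1.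
Qed.

Lemma inverse_full_twist r : (0 < r <= p)%N ->
  burau (braid_inv (sigma_chain p r)) ^+ r = scaling_mx r + first_strands r *m twist_row r r.
Proof.
move=> rp; apply: eq_mx_on_vec => f; have [r_gt0 le_rp] := andP rp.
rewrite inverse_chain_exp_vec // mulmxDl scaling_mx_vec -mulmxA.
rewrite twist_row_vec ?le_rp ?leqnn // mul_mx_scalar; apply/colP => i; rewrite !mxE.
case: ltnP => ir; last by rewrite mulr0 addr0 mul1r.
by rewrite addnK mulr1.
Qed.

Hypothesis t_neq0 : t != 0.

Lemma burau_positive_letter (g : 'I_p.-1) f :
  burau_letter (g, true) *m vec f =
  vec (fun i => if i == g then t^-1 * (f g.+1 - (1 - t) * f g)
                else if i == g.+1 then f g else f i).
Proof.
apply/colP => i; rewrite burau_letter_vec mxE /outgoing_coef /swap_coef /goes_under /=.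
rewrite val_swap_adjacent.
case: (eqVneq (i : nat) g) => [->|ig] /=; first by field.
by rewrite invrN invr1 opprK !mul1r !mul0r add0r; case: ifP.
Qed.

Lemma burau_letter_inv x : burau_letter (x.1, ~~ x.2) *m burau_letter x = 1%:M.
Proof.
have key g : burau_letter (g, false) *m burau_letter (g, true) = 1%:M.
  apply: eq_mx_on_vec => f; rewrite -mulmxA mul1mx burau_positive_letter burau_negative_letter.
  apply: eq_vec => i _; rewrite !eqxx.
  case: (eqVneq i g) => [->|ig] /=; first by rewrite (gtn_eqF (ltnSn g)).
  case: (eqVneq i g.+1) => [->|//] /=; rewrite (gtn_eqF (ltnSn g)); by field.
case: x => g [] /=; first exact: key.
by rewrite (mulmx1C (key g)).
Qed.

Lemma burau_inv w : burau (braid_inv w) *m burau w = 1%:M.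
Proof.
elim: w => [|x w IH]; first by rewrite mul1mx.
rewrite /braid_inv /= rev_cons burau_rcons burau_cons -mulmxA [X in _ *m X]mulmxA IH mul1mx.
exact: burau_letter_inv.
Qed.

(** The matrix of a negative letter is a rank-one perturbation of the identity,
   with determinant - t. *)
Lemma monomial_unit_det_burau w : monomial_unit t (\det (burau w)).
Proof.
have negative g : \det (burau_letter (g, false)) = - t.
  have g1p : (g.+1 < p)%N by have := ltn_ord g; lia.
  pose x := vec (fun i => (i == g)%:R - t * (i == g.+1)%:R).
  have -> : burau_letter (g, false) = 1%:M + x *m (eval_row g.+1 - eval_row g).
    apply: eq_mx_on_vec => f; rewrite burau_negative_letter mulmxDl mul1mx -mulmxA mulmxBl.
    rewrite !eval_row_vec ?(ltnW g1p) // -raddfB /= mul_mx_scalar; apply/colP => i; rewrite !mxE.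
    case: (eqVneq (i : nat) g) => [->|ig]; first by rewrite ltn_eqF //=; ring.
    case: (eqVneq (i : nat) g.+1) => [->|ig1] /=; ring.
  rewrite (det_add_rank1 _ (mul1mx x)) det1 mul1r mulmxBl !eval_row_vec ?(ltnW g1p) //.
  by rewrite !mxE !eqxx gtn_eqF // ltn_eqF //=; ring.
have uN : monomial_unit t (- t).
  by rewrite -mulN1r; apply: monomial_unitM (monomial_unitN1 _) (monomial_unit_t _).
elim: w => [|x w IH]; first by rewrite /burau /= det1; apply: monomial_unit1.
rewrite burau_cons det_mulmx; apply: monomial_unitM => //.
case: x => g [|]; last by rewrite negative.
have := congr1 determinant (burau_letter_inv (g, true)).
rewrite det_mulmx negative det1 => e.
have -> : \det (burau_letter (g, true)) = (- t)^-1.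
  have nz := monomial_unit_neq0 t_neq0 uN.
  by apply: (mulfI nz); rewrite e mulfV.
exact: monomial_unitV.
Qed.

(** Multiplying 1 - K_r^r K_p^(-q) + 1 y by K_p^q on the right gives
   K_p^q - K_r^r + 1 y K_p^q, and y = - twist_row K_p^(-q) cancels the part of K_p^q
   with equal rows. *)
Lemma det_burau_twisted_torus q r : (0 < q <= p)%N -> (0 < r <= p)%N ->
  exists2 y : 'rV[F]_p, (y *m const_mx 1 : 'cV_1) 0 0 = t ^+ q - 1 &
  exists2 u, monomial_unit t u &
    \det (1%:M - burau (twisted_torus_braid p q r (-1)) + const_mx 1 *m y)
    = u * \det (scaling_mx r - rotation_mx q + first_strands r *m twist_row r r).
Proof.
move=> /andP[q_gt0 qp] rp; have [r_gt0 le_rp] := andP rp.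
have p_gt0 : (0 < p)%N by apply: leq_trans qp.
set Bp := burau (sigma_chain p p); set Kp := burau (braid_inv (sigma_chain p p)).
set Kr := burau (braid_inv (sigma_chain p r)).
have -> : burau (twisted_torus_braid p q r (-1)) = Kr ^+ r *m Bp ^+ q.
  rewrite /twisted_torus_braid burau_cat -burau_flatten_nseq mulrN1.
  by case: (r) r_gt0 => // r' _; rewrite -NegzE /= -burau_flatten_nseq.
have BK : Bp ^+ q *m Kp ^+ q = 1%:M.
  have KB : Kp *m Bp = 1%:M := burau_inv (sigma_chain p p).
  have BK := mulmx1C KB.
  rewrite -[_ *m _]/(_ * _) -exprMn_comm; last by rewrite /GRing.comm [Bp * _]BK [Kp * _]KB.
  by rewrite [Bp * _]BK expr1n.
have Bp1 : Bp ^+ q *m const_mx 1 = const_mx 1 :> 'cV_p.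
  by rewrite -burau_flatten_nseq burau_1.
have ones : const_mx 1 = vec (fun=> 1) by apply/colP => i; rewrite !mxE.
exists (- twist_row q p *m Bp ^+ q).
  rewrite -mulmxA Bp1 mulNmx ones twist_row_vec ?qp ?leqnn // !mxE eqxx mulr1n.
  under eq_bigr => k _ do rewrite mulr1.
  by rewrite -mulNr opprB -subrX1.
exists ((-1) ^+ p * (\det (Kp ^+ q))^-1).
  apply: monomial_unitM; first exact/monomial_unitX/monomial_unitN1.
  apply: monomial_unitV => //; rewrite -burau_flatten_nseq; exact: monomial_unit_det_burau.
have det_neq0 : \det (Kp ^+ q) != 0.
  by rewrite -burau_flatten_nseq; apply/monomial_unit_neq0/monomial_unit_det_burau.
apply: (mulIf det_neq0); rewrite -det_mulmx [RHS]mulrAC mulfVK // -detZ; congr (\det _).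
rewrite mulmxDl mulmxBl mul1mx -!mulmxA BK !mulmx1 inverse_full_twist // /Kp inverse_chain_exp //.
rewrite scaleN1r mulmxN !opprD opprK.
by rewrite addrAC addrK addrA [in RHS](addrC (- _)).
Qed.

End Chains.

Lemma twisted_torus_minor (F : fieldType) (phi : {rmorphism {poly int} -> F}) p q r
    (D := twisted_torus_knot p q r (-1)) (i j : 'I_#|edge D|) (t := phi 'X) :
  t != 0 -> \sum_(k < p) t ^+ k != 0 -> t ^+ q - 1 != 0 ->
  (1 < p)%N -> (0 < q <= p)%N -> (0 < r <= p)%N ->
  exists2 u, monomial_unit t u &
    phi (\det (row' i (col' j (alexander_matrix D)))) * ((\sum_(k < p) t ^+ k) * (t ^+ q - 1))
    = u * \det (scaling_mx t p r - rotation_mx t p q + first_strands F p r *m twist_row t p r r).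
Proof.
move=> t_neq0 S_neq0 q_neq0 p_gt1 qp rp.
have [y y1 [u1 uu1 e1]] := det_burau_twisted_torus t_neq0 qp rp.
have y_neq0 : (y *m const_mx 1 : 'cV_1) 0 0 != 0 by rewrite y1.
have w_gt0 : (0 < size (twisted_torus_braid p q r (-1)))%N.
  rewrite size_cat /=; case/andP: qp; case: q {q_neq0 y1 e1 D i j} => // q' _ _.
  rewrite /= size_cat -addnA ltn_addr // size_map size_filter -has_count.
  have p1 : (0 < p.-1)%N by lia.
  by apply/hasP; exists (Ordinal p1); rewrite ?mem_enum.
have [u2 uu2] := closed_braid_minor t_neq0 w_gt0 i j S_neq0 y_neq0.
rewrite y1 e1 mulrA => e2; exists (u2 * u1); first exact: monomial_unitM.
by rewrite mulrA; exact: e2.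
Qed.

(** * The linear system of T(6n-1, 2n; 3n, -1) *)

Section Resolvent.

Variables (R : comNzRingType) (t : R) (n : nat).

Definition geom k : R := \sum_(j < k) t ^+ (3 * n * j).

(** The rescaled solution Y on the first 3n strands.  On the cycle of the shift
   i |-> i + 2n modulo 6n - 1 these strands come in the order
     0, 2n, 1, 2n+1, ..., n-1, 3n-1, n, n+1, ..., 2n-1,
   and Y_i is the sum, over all starting points j among them, of t^(4n) times the
   weight of the path from j to i: t^(2n) for each step and t^(-3n) for each
   visited strand among the first 3n, both ends included.  The way from i over
   2n + i to i + 1 for i < n multiplies the weight by 1, and the way from i to i + 1
   for n <= i < 2n - 1 by t^(3n): hence the integers and the geometric sums.  The
   terms with the factor t^(n (3n-2)), the weight of the whole cycle, come from
   paths that pass from strand 2n - 1 on to strand 0. *)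
Definition resolvent (i : nat) : R :=
  if (i < n)%N then
    t ^+ n * (i.+1%:R + i%:R * t ^+ n + t ^+ n * geom n
      + t ^+ (n * (3 * n - 2)) * ((n%:R - i.+1%:R) + (n%:R - i%:R) * t ^+ n))
  else if (i < 2 * n)%N then
    t ^+ n * (n%:R * (1 + t ^+ n) * t ^+ (3 * n * (i - n)) + geom (i - n).+1
      + t ^+ n * (geom n.-1 - geom (i - n)))
  else
    ((i - 2 * n).+1%:R + t ^+ (n * (3 * n - 2)) * (n%:R - (i - 2 * n).+1%:R)) * (1 + t ^+ n)
      + t ^+ n * geom n.

(** The weight, times t^(4n), of the path from strand 0 to strand i. *)
Definition path_weight (i : nat) : R :=
  if (i < n)%N then t ^+ n
  else if (i < 2 * n)%N then t ^+ (n + 3 * n * (i - n)) else 1.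

(** The value f takes at the last strand among the first 3n that precedes i on the
   cycle, times t^(2n) for each of the steps (one, two or three) from there to i. *)
Definition first_return (f : nat -> R) (i : nat) : R :=
  if i == 0%N then t ^+ (4 * n) * f (2 * n).-1
  else if (i <= n)%N then t ^+ (4 * n) * f (2 * n + i.-1)%N
  else if (i < 2 * n)%N then t ^+ (6 * n) * f i.-1
  else t ^+ (2 * n) * f (i - 2 * n)%N.

Lemma geomS k : geom k.+1 = geom k + t ^+ (3 * n * k).
Proof. by rewrite /geom big_ord_recr. Qed.

Lemma geomSl k : geom k.+1 = 1 + t ^+ (3 * n) * geom k.
Proof.
rewrite /geom big_ord_recl muln0 expr0 mulr_sumr; congr (_ + _).
by apply: eq_bigr => j _; rewrite -exprD /= -mulnS.
Qed.

Lemma path_weight_first_return i : (0 < i < 3 * n)%N ->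
  t ^+ (3 * n) * path_weight i = first_return path_weight i.
Proof.
case/andP=> i_gt0 i_lt; rewrite /first_return /path_weight.
have [i0|i0] := eqVneq; first by lia.
case: (ltnP i n) => lt1.
  rewrite (ltnW lt1) !ifF; [|lia|lia]; rewrite mulr1 -exprD; congr (t ^+ _); lia.
case: (ltnP n i) => lt2.
  case: ltnP => lt3.
    rewrite ifF; last by lia.
    rewrite ifT; last by lia.
    rewrite -!exprD; congr (t ^+ _); nia.
  rewrite ifT; last by lia.
  rewrite mulr1 -exprD; congr (t ^+ _); lia.
rewrite ifT; last by lia.
rewrite !ifF; [|lia|lia].
rewrite mulr1 -exprD; congr (t ^+ _); nia.
Qed.

Lemma resolvent_first_return i : (0 < n)%N -> (i < 3 * n)%N ->
  t ^+ (3 * n) * resolvent i =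
  first_return resolvent i + t ^+ (4 * n) * (1 - t ^+ (n * (3 * n - 2))).
Proof.
move=> n_gt0 i_lt.
have eE : t ^+ (n * (3 * n - 2)) = t ^+ n * t ^+ (3 * n * n.-1).
  rewrite -exprD; congr (t ^+ _); nia.
have eg : geom n = geom n.-1 + t ^+ (3 * n * n.-1) by rewrite -geomS prednK.
have eX k : t ^+ (k * n) = (t ^+ n) ^+ k by rewrite mulnC exprM.
rewrite /first_return /resolvent.
have [->|i0] := eqVneq i 0%N.
  rewrite n_gt0 ifF; last by lia.
  rewrite ifT; last by lia.
  have -> : ((2 * n).-1 - n)%N = n.-1 by lia.
  rewrite eg eE -geomS prednK // eg !eX; ring.
case: (ltnP i n) => lt1.
  rewrite (ltnW lt1) !ifF; [|lia|lia].
  have -> : (2 * n + i.-1 - 2 * n).+1 = i by lia.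
  rewrite -[i.+1]addn1 natrD !eX; ring.
case: (ltnP n i) => lt2; last first.
  have -> : i = n by lia.
  rewrite ifT; last by lia.
  rewrite !ifF; [|lia|lia].
  have -> : (2 * n + n.-1 - 2 * n).+1 = n by lia.
  rewrite subnn muln0 geomS /geom !big_ord0 -/(geom _) -/(geom _) eg eE !eX muln0; ring.
case: ltnP => lt3.
  rewrite ifF; last by lia.
  rewrite ifT; last by lia.
  have [k ek] : exists k, i = (n + k.+1)%N by exists (i - n).-1; lia.
  have -> : (i - n = k.+1)%N by lia.
  have -> : (i.-1 - n = k)%N by lia.
  have e1 := geomSl k.+1; have e2 := geomSl n.-1; rewrite prednK // eg in e2.
  have e3 := geomSl k.
  have e4 : t ^+ (3 * n * k.+1) = t ^+ (3 * n) * t ^+ (3 * n * k) by rewrite -exprD mulnS.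
  rewrite eE e1 e4.
  have -> : t ^+ (6 * n) = t ^+ (3 * n) * t ^+ (3 * n) by rewrite -exprD; congr (t ^+ _); lia.
  have -> : t ^+ (4 * n) = t ^+ (3 * n) * t ^+ n by rewrite -exprD; congr (t ^+ _); lia.
  have -> : t ^+ (3 * n * n.-1) = 1 + t ^+ (3 * n) * geom n.-1 - geom n.-1.
    by rewrite -e2; ring.
  rewrite e3; ring.
rewrite ifT; last by lia.
rewrite -[(i - 2 * n).+1]addn1 natrD !eX; ring.
Qed.

End Resolvent.

(** The polynomial H of the introduction, in a general ring because it is computed
   in a field but its coefficients are read off in Z[t]. *)
Definition twisted_numerator (R : comNzRingType) (t : R) (n : nat) : R :=
  t ^+ (4 * n) * (1 - t ^+ (n * (3 * n - 2)))
  + (1 - t) * \sum_(k < 3 * n) t ^+ k * resolvent t n (3 * n - 1 - k)%N.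

(** * The determinant as an explicit polynomial *)

Section Determinant.

Variables (F : fieldType) (t : F) (n : nat).
Local Notation p := (6 * n - 1)%N.
Local Notation q := (2 * n)%N.
Local Notation r := (3 * n)%N.
Local Notation E := (n * (3 * n - 2))%N.
Local Notation vec := (@vec F p).
Hypothesis n_gt0 : (0 < n)%N.

(** The values on the strands 3n, 3n+1, ... are forced by their rows of the system,
   t^(2n) per step; this eliminates these strands. *)
Definition extend_along_orbit (f : nat -> F) (i : nat) : F :=
  if (i < 3 * n)%N then f i
  else if (i < 5 * n)%N then t ^+ (2 * n) * f (i - 2 * n)%N
  else t ^+ (4 * n) * f (i - 4 * n)%N.

Lemma cyclic_row_extend f i : (i < p)%N ->
  (if (i < r)%N then t ^+ r else 1) * extend_along_orbit f i
  - t ^+ q * extend_along_orbit f (if (q <= i)%N then i - q else i + p - q)%N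
  = if (i < r)%N then t ^+ r * f i - first_return t n f i else 0.
Proof.
move=> ip.
have e42 : t ^+ (4 * n) = t ^+ (2 * n) * t ^+ (2 * n) by rewrite -exprD; congr (t ^+ _); lia.
have e62 : t ^+ (6 * n) = t ^+ (2 * n) * t ^+ (4 * n) by rewrite -exprD; congr (t ^+ _); lia.
rewrite /extend_along_orbit /first_return; case: (ltnP i (3 * n)) => lt3.
  congr (_ - _); case: (ltnP i (2 * n)) => lt2; last first.
    rewrite ifT; last by lia.
    rewrite ifF; last by lia.
    by rewrite ifF //; lia.
  have [i0|i0] := eqVneq i 0%N.
    rewrite ifF; last by lia.
    rewrite ifT; last by lia.
    have -> : (i + (6 * n - 1) - 2 * n - 2 * n = (2 * n).-1)%N by lia.
    by rewrite e42 mulrA.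
  case: (leqP i n) => lt1.
    rewrite ifF; last by lia.
    rewrite ifT; last by lia.
    have -> : (i + (6 * n - 1) - 2 * n - 2 * n = 2 * n + i.-1)%N by lia.
    by rewrite e42 mulrA.
  rewrite ifF; last by lia.
  rewrite ifF; last by lia.
  have -> : (i + (6 * n - 1) - 2 * n - 4 * n = i.-1)%N by lia.
  by rewrite e62 mulrA.
rewrite mul1r; apply/eqP; rewrite subr_eq0; apply/eqP.
have -> : (if (2 * n <= i)%N then i - 2 * n else i + (6 * n - 1) - 2 * n)%N = (i - 2 * n)%N.
  by rewrite ifT //; lia.
case: (ltnP i (5 * n)) => lt5; first by rewrite ifT //; lia.
rewrite ifF; last by lia.
rewrite ifT; last by lia.
by rewrite -subnDA e42 mulrA; congr (_ * f _); lia.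
Qed.

Local Notation M := (scaling_mx t p r - rotation_mx t p q).
Local Notation e0 := (vec (fun i => (i == 0)%N%:R)).

(* The cycle cut open before strand 0. *)
Let low : 'M[F]_p :=
  scaling_mx t p r - \matrix_(i, j) ((i != 0 :> nat)%:R * rotation_mx t p q i j).

Let M_low : M = low + e0 *m (- (t ^+ q *: eval_row F p (p - q))).
Proof.
apply/matrixP => i j; rewrite !mxE big_ord1 !mxE -addrA.
congr (_ + _); case: (eqVneq (i : nat) 0%N) => [->|_] /=.
  by rewrite ifF ?add0n; [ring|lia].
by rewrite mul1r mul0r addr0.
Qed.

Let solve f g : (forall i, (i < r)%N -> t ^+ r * f i - first_return t n f i = g i) ->
  M *m vec (extend_along_orbit f) = vec (fun i => if (i < r)%N then g i else 0).
Proof.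
move=> fg; rewrite mulmxBl scaling_mx_vec rotation_mx_vec; last by lia.
apply/colP => i; rewrite !mxE (cyclic_row_extend _ (ltn_ord i)); case: ifP => //; exact: fg.
Qed.

Hypothesis t_neq0 : t != 0.

Let det_low : monomial_unit t (\det low).
Proof.
(* Strand i is the (position i)-th one on the cycle, starting from strand 0. *)
pose position (i : 'I_p) := (if i < 2 * n then 3 * i else
  if i < 4 * n then 3 * (i - 2 * n) + 1 else 3 * (i - 4 * n) + 2)%N.
rewrite (@det_ranked_triangular _ _ _ position).
  apply: monomial_unit_prod => i; rewrite !mxE eqxx mulr1n.
  have -> : (i == (if q <= i then i - q else i + p - q)%N :> nat) = false.
    by have := ltn_ord i; case: ifP; lia.
  rewrite !mulr0 subr0; case: ifP => _; last exact: monomial_unit1.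
  exact/monomial_unitX/monomial_unit_t.
move=> i j; rewrite !mxE => nz ij; move: nz.
rewrite (negPf ij) mulr0n sub0r oppr_eq0.
case: (eqVneq (i : nat) 0%N) => [_|i0]; first by rewrite mul0r eqxx.
set i' := (if _ then _ else _).
case: (eqVneq (j : nat) i') => [ji|_]; last by rewrite !mulr0 eqxx.
move=> _; rewrite /position ji /i'; have := ltn_ord i; do !case: ifP; lia.
Qed.

Hypothesis tE_neq1 : 1 - t ^+ E != 0.

(** Two rank-one updates: closing the cycle multiplies the triangular determinant
   by one minus the weight of the cycle, and the full twist then brings in the
   resolvent. *)
Lemma det_twisted_torus :
  exists2 u, monomial_unit t u &
   \det (M + first_strands F p r *m twist_row t p r r) = u * twisted_numerator t n.
Proof.
have pq : (p - q < p)%N by lia.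
have pw_last : path_weight t n (2 * n).-1 = t ^+ E.
  rewrite /path_weight ifF; last by lia.
  rewrite ifT; last by lia.
  by congr (t ^+ _); nia.
have z_last : t ^+ q * extend_along_orbit (path_weight t n) (p - q) = t ^+ (4 * n) * t ^+ E.
  rewrite /extend_along_orbit ifF; last by lia.
  rewrite ifT; last by lia.
  rewrite (_ : (p - q - 2 * n = (2 * n).-1)%N) ?pw_last; last by lia.
  by rewrite mulrA -exprD; congr (t ^+ _ * _); lia.
have t4_neq0 : t ^+ (4 * n) != 0 by rewrite expf_neq0.
have det_M : \det M = \det low * (1 - t ^+ E).
  pose z := vec (extend_along_orbit (path_weight t n)).
  have Mz : M *m z = vec (fun i => if (i < r)%N
      then (i == 0)%N%:R * (t ^+ (4 * n) - t ^+ (4 * n) * t ^+ E) else 0).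
    apply: (@solve _ (fun i => (i == 0)%N%:R * (t ^+ (4 * n) - t ^+ (4 * n) * t ^+ E))) => i ir.
    have [->|i0] := eqVneq i 0%N.
      rewrite /first_return /= pw_last /path_weight n_gt0 mul1r; congr (_ - _).
      by rewrite -exprD; congr (t ^+ _); lia.
    by rewrite path_weight_first_return ?subrr ?mul0r ?lt0n ?i0.
  have lowz : low *m (t ^- (4 * n) *: z) = e0.
    rewrite -scalemxAr.
    have -> : low = M + e0 *m (t ^+ q *: eval_row F p (p - q)).
      by rewrite M_low mulmxN addrNK.
    rewrite mulmxDl Mz -mulmxA -scalemxAl eval_row_vec // scale_scalar_mx mul_mx_scalar z_last.
    apply/colP => i; rewrite !mxE; case: (eqVneq (i : nat) 0%N) => [->|i0].
      rewrite muln_gt0 n_gt0 /=; by field.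
    by rewrite mul0r mulr0 if_same addr0 mulr0.
  rewrite M_low (det_add_rank1 _ lowz) mulNmx -scalemxAl -scalemxAr /z eval_row_vec //.
  congr (_ * _); rewrite !mxE eqxx mulr1n mulrCA z_last; by field.
pose c := t ^+ (4 * n) * (1 - t ^+ E).
have c_neq0 : c != 0 by rewrite mulf_neq0 // expf_neq0.
have MY : M *m (c^-1 *: vec (extend_along_orbit (resolvent t n))) = first_strands F p r.
  rewrite -scalemxAr (@solve _ (fun=> c)).
    by apply/colP => i; rewrite !mxE; case: ifP; rewrite ?mulr0 // mulVf.
  by move=> i ir; rewrite resolvent_first_return // addrAC subrr add0r.
exists (\det low * t ^- (4 * n)).
  apply: monomial_unitM => //; apply: monomial_unitV => //.
  exact/monomial_unitX/monomial_unit_t.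
rewrite (det_add_rank1 _ MY) det_M -scalemxAr twist_row_vec; last by lia.
rewrite !mxE eqxx mulr1n /twisted_numerator.
have -> : \sum_(k < r) t ^+ k * extend_along_orbit (resolvent t n) (r.-1 - k)%N
   = \sum_(k < r) t ^+ k * resolvent t n (r - 1 - k)%N.
  by apply: eq_bigr => k _; rewrite subn1 /extend_along_orbit ifT //; lia.
rewrite -!mulrA; congr (_ * _); rewrite /c; field.
by rewrite t4_neq0 tE_neq1.
Qed.

End Determinant.

(** * The extreme terms of the numerator *)

Lemma rmorph_twisted_numerator (R S : comNzRingType) (f : {rmorphism R -> S}) (t : R) n :
  f (twisted_numerator t n) = twisted_numerator (f t) n.
Proof.
have fgeom k : f (geom t n k) = geom (f t) n k.
  by rewrite rmorph_sum; apply: eq_bigr => j _; rewrite rmorphXn.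
have fsol i : f (resolvent t n i) = resolvent (f t) n i.
  rewrite /resolvent; do 2?case: ifP => _;
  by rewrite !(rmorphD, rmorphB, rmorphM, rmorphN, rmorphXn, rmorph1, rmorph_nat, fgeom).
rewrite /twisted_numerator !(rmorphD, rmorphB, rmorphM, rmorphN, rmorphXn, rmorph1) rmorph_sum.
congr (_ + _ * _); apply: eq_bigr => k _; by rewrite rmorphM rmorphXn fsol.
Qed.

(** At t = 0 only Y_(3n-1) contributes, through the n paths from the strands below n
   to 3n - 1, whose rescaled weight is 1. *)
Lemma twisted_numerator_at_0 n : (0 < n)%N -> (twisted_numerator 'X n : {poly int}).[0] = n%:R.
Proof.
move=> n_gt0.
have -> : (twisted_numerator 'X n : {poly int}).[0] = twisted_numerator 0 n.
  by rewrite -[LHS]/(horner_eval 0 _) rmorph_twisted_numerator /= /horner_eval hornerX.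
have E_gt0 : (0 < n * (3 * n - 2))%N by rewrite muln_gt0; lia.
have z k : (0 < k)%N -> (0 : int) ^+ k = 0 by move=> k0; rewrite expr0n gtn_eqF.
rewrite /twisted_numerator (z (4 * n)%N) ?muln_gt0 // mul0r add0r subr0 mul1r.
have [m em] : exists m, (3 * n = m.+1)%N by exists (3 * n).-1; lia.
rewrite em big_ord_recl expr0 mul1r big1 ?addr0; last by move=> k _; rewrite z // mul0r.
have -> : (m.+1 - 1 - @ord0 m = 3 * n - 1)%N by rewrite /= em; lia.
rewrite /resolvent ifF; last by lia.
rewrite ifF; last by lia.
rewrite (z _ E_gt0) (z n) // !mul0r !addr0 mulr1; congr (_%:R); lia.
Qed.

Definition deg_le (d : nat) (p : {poly int}) : bool := (size p <= d.+1)%N.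

Lemma deg_leW d e p : (d <= e)%N -> deg_le d p -> deg_le e p.
Proof. by move=> de /leq_trans; apply. Qed.

Lemma deg_leD d p q : deg_le d p -> deg_le d q -> deg_le d (p + q).
Proof. by move=> dp dq; apply: leq_trans (size_polyD _ _) _; rewrite geq_max; apply/andP. Qed.

Lemma deg_leN d p : deg_le d p -> deg_le d (- p).
Proof. by rewrite /deg_le size_polyN. Qed.

Lemma deg_leB d p q : deg_le d p -> deg_le d q -> deg_le d (p - q).
Proof. by move=> dp dq; apply/deg_leD/deg_leN. Qed.

Lemma deg_leM d e p q : deg_le d p -> deg_le e q -> deg_le (d + e) (p * q).
Proof. by rewrite /deg_le => dp dq; apply: leq_trans (size_polyMleq _ _) _; lia. Qed.

Lemma deg_le_nat d (k : nat) : deg_le d k%:R.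
Proof. by apply: (@deg_leW 0) => //; rewrite /deg_le -polyC_natr size_polyC_leq1. Qed.

Lemma deg_le_Xn d k : (k <= d)%N -> deg_le d 'X^k.
Proof. by move=> kd; rewrite /deg_le size_polyXn. Qed.

Lemma deg_le_XnM d k p : (k <= d)%N -> deg_le (d - k) p -> deg_le d ('X^k * p).
Proof. by move=> kd dp; rewrite -[d](subnKC kd); apply: deg_leM => //; apply: deg_le_Xn. Qed.

Lemma deg_le_sum d (I : finType) (Q : pred I) (G : I -> {poly int}) :
  (forall i, Q i -> deg_le d (G i)) -> deg_le d (\sum_(i | Q i) G i).
Proof. by move=> h; elim/big_ind: _ => //; [rewrite /deg_le size_poly0|apply: deg_leD]. Qed.

Lemma deg_le_geom d n k : (3 * n * k.-1 <= d)%N -> deg_le d (geom 'X n k).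
Proof. by move=> kd; apply: deg_le_sum => j _; apply: deg_le_Xn; have := ltn_ord j; nia. Qed.

Lemma deg_le_resolvent n i : (i < 3 * n)%N ->
  deg_le (n * (3 * n - 2) + (if (i < n)%N then 2 * n else n)) (resolvent 'X n i).
Proof.
move=> i_lt; rewrite /resolvent.
have E1 : (n * (3 * n - 2) = 3 * n * n.-1 + n)%N by nia.
move: (n * (3 * n - 2))%N E1 => E E1.
case: (ltnP i n) => lt1; [|case: (ltnP i (2 * n)) => lt2].
- apply: deg_le_XnM; first by lia.
  apply: (@deg_leW (E + n)); first by lia.
  apply: deg_leD; [apply: deg_leD; [apply: deg_leD|]|].
  + exact: deg_le_nat.
  + rewrite mulrC; apply: deg_le_XnM; [lia|exact: deg_le_nat].
  + apply: deg_le_XnM; [lia|apply: deg_le_geom; lia].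
  + apply: deg_le_XnM; first by lia.
    apply: deg_leD; first by apply: deg_leB; exact: deg_le_nat.
    rewrite mulrC; apply: deg_le_XnM; [lia|].
    by apply: deg_leB; exact: deg_le_nat.
- have ik : (i - n <= n.-1)%N by lia.
  have h : (3 * n * (i - n) <= 3 * n * n.-1)%N by rewrite leq_mul2l ik orbT.
  apply: deg_le_XnM; first by lia.
  rewrite addnK; apply: deg_leD; first apply: deg_leD.
  + rewrite mulrC; apply: deg_le_XnM; first by lia.
    rewrite -[X in deg_le X](add0n); apply: deg_leM; first exact: deg_le_nat.
    apply: deg_leD; [exact: (deg_le_nat _ 1)|apply: deg_le_Xn; lia].
  + apply: deg_le_geom; lia.
  + apply: deg_le_XnM; first by lia.
    apply: deg_leB; apply: deg_le_geom; nia.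
apply: deg_leD; last by apply: deg_le_XnM; [lia|apply: deg_le_geom; lia].
apply: deg_leM.
  apply: deg_leD; first exact: deg_le_nat.
  rewrite -[X in deg_le X]addn0; apply: deg_leM; first exact: deg_le_Xn.
  by apply: deg_leB; exact: deg_le_nat.
by apply: deg_leD; [exact: (deg_le_nat _ 1)|exact: deg_le_Xn].
Qed.

(** The top term comes from Y_0 alone, through the n paths from the strands 2n + j,
   j < n, around the cycle to 0, whose rescaled weight is t^(n (3n-2) + 2n). *)
Lemma twisted_numerator_top n : (0 < n)%N ->
  let D := (n * (3 * n - 2) + 5 * n)%N in
  exists2 Q : {poly int}, deg_le D.-1 Q & twisted_numerator 'X n = Q - n%:R * 'X^D.
Proof.
move=> n_gt0 D; pose E := (n * (3 * n - 2))%N.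
have E1 : E = (3 * n * n.-1 + n)%N by rewrite /E; nia.
pose V : {poly int} := 'X^n + 'X^(2 * n) * geom 'X n n + (n%:R - 1) * 'X^(E + n).
have dV : deg_le (E + 2 * n - 1) V.
  apply: deg_leD; first apply: deg_leD.
  - apply: deg_le_Xn; lia.
  - apply: deg_le_XnM; [lia|apply: deg_le_geom; lia].
  - rewrite mulrC; apply: deg_le_XnM; [lia|].
    by apply: deg_leB; [exact: deg_le_nat|exact: (deg_le_nat _ 1)].
have sol0 : resolvent 'X n 0 = V + n%:R * 'X^(E + 2 * n).
  rewrite /resolvent n_gt0 /V -/E (_ : 2 * n = n + n)%N; last by lia.
  by rewrite !exprD; ring.
have [m em] : exists m, (3 * n = m.+1)%N by exists (3 * n).-1; lia.
pose W' : {poly int} := \sum_(k < m) 'X^k * resolvent 'X n (3 * n - 1 - k)%N + 'X^m * V.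
have dW' : deg_le (D - 2) W'.
  apply: deg_leD.
    apply: deg_le_sum => k _; have km := ltn_ord k.
    apply: deg_le_XnM; first by rewrite /D; lia.
    have il : (3 * n - 1 - k < 3 * n)%N by lia.
    apply: deg_leW (deg_le_resolvent il); rewrite /D -/E.
    by case: ifP; lia.
  apply: deg_le_XnM; first by rewrite /D; lia.
  apply: deg_leW dV; rewrite /D -/E; lia.
have eW : \sum_(k < 3 * n) 'X^k * resolvent 'X n (3 * n - 1 - k)%N = W' + n%:R * 'X^(D - 1).
  rewrite em big_ord_recr /= -em (_ : 3 * n - 1 - m = 0)%N; last by lia.
  rewrite sol0 /W' mulrDr addrA; congr (_ + _).
  rewrite mulrCA -exprD; congr (_ * 'X^_); rewrite /D -/E; lia.
exists ('X^(4 * n) * (1 - 'X^E) + W' + n%:R * 'X^(D - 1) - 'X * W').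
  apply: deg_leB; first apply: deg_leD; first apply: deg_leD.
  - apply: deg_le_XnM; first by rewrite /D; lia.
    apply: deg_leB; first exact: (deg_le_nat _ 1).
    apply: deg_le_Xn; rewrite /D -/E; lia.
  - apply: deg_leW dW'; lia.
  - rewrite mulrC; apply: deg_le_XnM; [lia|exact: deg_le_nat].
  - rewrite -['X]expr1; apply: deg_le_XnM; first by rewrite /D; lia.
    apply: deg_leW dW'; lia.
have eD : 'X^D = 'X * 'X^(D - 1) :> {poly int} by rewrite -exprS; congr 'X^_; rewrite /D; lia.
rewrite /twisted_numerator eW eD -/E; ring.
Qed.

Lemma size_twisted_numerator n : (0 < n)%N ->
  size (twisted_numerator 'X n : {poly int}) = (n * (3 * n - 2) + 5 * n).+1 /\
  lead_coef (twisted_numerator 'X n : {poly int}) = - n%:R.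
Proof.
move=> n_gt0; have [Q dQ ->] := twisted_numerator_top n_gt0.
set D := (n * _ + _)%N in dQ *.
have eD : D = D.-1.+1 by rewrite /D; lia.
have szn : size (- n%:R * 'X^D : {poly int}) = D.+1.
  rewrite mulNr size_polyN -polyC_natr mul_polyC size_scale ?size_polyXn //.
  by rewrite Num.Theory.pnatr_eq0 -lt0n.
have lt : (size Q < size (- n%:R * 'X^D : {poly int})%R)%N by rewrite szn eD ltnS.
rewrite -mulNr addrC size_polyDl // lead_coefDl // szn; split => //.
by rewrite mulNr lead_coefN -polyC_natr mul_polyC lead_coefZ lead_coefXn mulr1.
Qed.

Lemma neq0_of_horner0 (p : {poly int}) : p.[0] != 0 -> p != 0.
Proof. by apply: contraNneq => ->; rewrite horner0. Qed.

(** * Degrees of Laurent polynomials up to units *)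

Lemma factor_lowest_exponent (P : {poly int}) : P != 0 ->
  exists2 Q : {poly int}, Q.[0] != 0 & P = 'X^(lowest_exponent P) * Q.
Proof.
move=> P_neq0; rewrite /lowest_exponent; set v := find _ P.
have hasP : has (predC1 0) P.
  apply/hasP; exists (lead_coef P); last by rewrite /= lead_coef_eq0.
  by rewrite /lead_coef mem_nth // polySpred.
exists (drop_poly v P).
  by rewrite horner_coef0 coef_drop_poly add0n; exact: (nth_find 0 hasP).
rewrite -{1}[P](poly_take_drop v) mulrC [X in X + _](_ : _ = 0) ?add0r //.
apply/polyP => k; rewrite coef_take_poly coef0; case: ifP => // kv.
by have := before_find 0 kv => /negbFE /eqP.
Qed.

Lemma laurent_degree_quotient (P T H : {poly int}) a b (c : bool) :
  T.[0] != 0 -> H.[0] != 0 -> 'X^a * P * T = (-1) ^+ c * 'X^b * H ->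
  (leading_coefficient P * leading_coefficient T = leading_coefficient H)%N /\
  (laurent_degree P + size T = size H)%N.
Proof.
move=> T0 H0 e.
have X0 k : ('X^k : {poly int}) != 0 by rewrite monic_neq0 ?monicXn.
have s0 : ((-1) ^+ c : {poly int}) != 0 by rewrite signr_eq0.
have P_neq0 : P != 0.
  apply: contraNneq (neq0_of_horner0 H0) => P0; move: e; rewrite P0 mulr0 mul0r => /esym/eqP.
  by rewrite !mulf_eq0 (negPf s0) (negPf (X0 _)).
have [Q Q0 eP] := factor_lowest_exponent P_neq0.
set v := lowest_exponent P in eP.
have eQT : Q * T = (-1) ^+ c * H.
  have e1 : 'X^(a + v) * (Q * T) = 'X^b * ((-1) ^+ c * H).
    rewrite [RHS]mulrCA [RHS]mulrA -e [in RHS]eP exprD !mulrA //.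
  have e0 k (U V : {poly int}) : U.[0] != 0 -> 'X^(k.+1) * V != U.
    by apply: contraNneq => <-; rewrite hornerM hornerXn expr0n mul0r.
  have QT0 : (Q * T).[0] != 0 by rewrite hornerM mulf_neq0.
  have sH0 : ((-1) ^+ c * H).[0] != 0.
    by rewrite hornerM mulf_neq0 // horner_exp hornerN hornerC signr_eq0.
  case: (ltngtP (a + v) b) => [lt|lt|eq]; last by apply: (mulfI (X0 b)); rewrite -e1 eq.
    have [k ek] : exists k, b = (a + v + k.+1)%N by exists (b - (a + v)).-1; lia.
    move: e1; rewrite ek [in RHS]exprD -[RHS]mulrA => h0; have /esym/eqP h := mulfI (X0 _) h0.
    by have := e0 k _ ((-1) ^+ c * H) QT0; rewrite h.
  have [k ek] : exists k, (a + v = b + k.+1)%N by exists ((a + v) - b).-1; lia.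
  move: e1; rewrite ek [in LHS]exprD -[LHS]mulrA => h0; have /eqP h := mulfI (X0 _) h0.
  by have := e0 k _ (Q * T) sH0; rewrite h.
have szP : size P = (v + size Q)%N.
  by rewrite {1}eP mulrC size_mulXn ?neq0_of_horner0.
have lcP : lead_coef P = lead_coef Q by rewrite eP lead_coefM lead_coefXn mul1r.
split; last first.
  have := congr1 (fun U : {poly int} => size U) eQT.
  rewrite size_Msign size_mul ?neq0_of_horner0 // /laurent_degree -/v szP.
  have : (0 < size Q)%N by rewrite size_poly_gt0 neq0_of_horner0.
  move: (size Q) (size T) (size H) => x y z; lia.
rewrite /leading_coefficient lcP -abszM -lead_coefM eQT.
rewrite lead_coefM abszM; case: (c); rewrite ?expr1 ?expr0 ?lead_coefN lead_coef1 ?abszN mul1n //.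
Qed.

Lemma torus_factor_shape (p q : nat) : (0 < p)%N -> (0 < q)%N ->
  let T : {poly int} := (\sum_(k < p) 'X^k) * ('X^q - 1) in
  [/\ T.[0] != 0, size T = (p + q)%N & leading_coefficient T = 1%N].
Proof.
move=> p_gt0 q_gt0 T.
have eS : \sum_(k < p) 'X^k = \poly_(k < p) 1 :> {poly int}.
  by rewrite poly_def; apply: eq_bigr => k _; rewrite scale1r.
have szS : size (\sum_(k < p) 'X^k : {poly int}) = p by rewrite eS size_poly_eq ?oner_eq0.
have lcS : lead_coef (\sum_(k < p) 'X^k : {poly int}) = 1 by rewrite eS lead_coef_poly ?oner_eq0.
have monS : (\sum_(k < p) 'X^k : {poly int}) \is monic by apply/monicP.
have monX : ('X^q - 1 : {poly int}) \is monic by rewrite monic_Xn_sub_1.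
split.
- rewrite hornerM eS horner_coef0 coef_poly p_gt0 mul1r !hornerE expr0n gtn_eqF //.
- by rewrite /T size_Mmonic ?monic_neq0 // szS size_Xn_sub_1 // addnS.
- by rewrite /leading_coefficient (monicP _) // monicMl.
Qed.

Theorem theorem1p3 (n : nat) (n_gt0 : (0 < n)%N) (P : {poly int})
    (P_alexander :
       is_alexander_poly (twisted_torus_knot (6 * n - 1) (2 * n) (3 * n) (-1)) P) :
  leading_coefficient P = n /\
  laurent_degree P = ((3 * n - 2) * (n - 1))%N.
Proof.
have [i [j [a [b [c eP]]]]] := P_alexander.
set p := (6 * n - 1)%N in i j eP *; set q := (2 * n)%N in i j eP *.
set r := (3 * n)%N in i j eP *.
have p_gt0 : (0 < p)%N by rewrite /p; lia.
have q_gt0 : (0 < q)%N by rewrite /q; lia.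
have E_gt0 : (0 < n * (3 * n - 2))%N by rewrite muln_gt0; lia.
have [T0 szT lcT] := torus_factor_shape p_gt0 q_gt0.
set T := (X in X.[0] != 0) in T0 szT lcT.
pose phi : {rmorphism {poly int} -> {fraction {poly int}}} := @tofrac {poly int}.
have phi_eq0 (U : {poly int}) : (phi U == 0) = (U == 0) := tofrac_eq0 U.
have phi_inj : injective phi by apply: raddf_inj => U /eqP; rewrite phi_eq0 => /eqP.
pose t := phi 'X.
have t_neq0 : t != 0 by rewrite phi_eq0 polyX_eq0.
have phiXn k : phi 'X^k = t ^+ k by rewrite rmorphXn.
have tE_neq1 : 1 - t ^+ (n * (3 * n - 2)) != 0.
  rewrite -phiXn -(rmorph1 phi) -rmorphB phi_eq0; apply: neq0_of_horner0.
  by rewrite !hornerE expr0n gtn_eqF.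
have eT : phi T = (\sum_(k < p) t ^+ k) * (t ^+ q - 1).
  rewrite rmorphM rmorphB rmorph1 phiXn rmorph_sum.
  by congr (_ * _); apply: eq_bigr => k _; exact: phiXn.
have [S_neq0 q_neq0] : \sum_(k < p) t ^+ k != 0 /\ t ^+ q - 1 != 0.
  by apply/andP; rewrite -negb_or -mulf_eq0 -eT phi_eq0 neq0_of_horner0.
have qp : (0 < q <= p)%N by apply/andP; split; lia.
have rp : (0 < r <= p)%N by apply/andP; split; lia.
have p_gt1 : (1 < p)%N by lia.
have [u1 uu1] := twisted_torus_minor i j t_neq0 S_neq0 q_neq0 p_gt1 qp rp.
have [u2 uu2 e2] := det_twisted_torus n_gt0 t_neq0 tE_neq1.
rewrite -/t -eT e2; set minor := \det _ => e3.
have [m [k [d eu]]] := monomial_unitM uu1 uu2.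
have e4 : 'X^m * (minor * T) = (-1) ^+ d * 'X^k * twisted_numerator 'X n.
  apply: phi_inj; rewrite rmorphM [phi (minor * T)]rmorphM e3 phiXn.
  rewrite !mulrA -[t ^+ m * _ * _]mulrA eu.
  by rewrite 2!rmorphM rmorph_sign phiXn rmorph_twisted_numerator.
have e5 : 'X^(a + m) * P * T = (-1) ^+ (c (+) d) * 'X^(b + k) * twisted_numerator 'X n.
  rewrite signr_addb !exprD.
  transitivity ('X^m * ('X^a * P) * T); first by ring.
  rewrite eP; transitivity ((-1) ^+ c * 'X^b * ('X^m * (minor * T))).
    by rewrite /minor; ring.
  by rewrite e4; ring.
have [H_size H_lead] := size_twisted_numerator n_gt0.
have H0 : (twisted_numerator 'X n : {poly int}).[0] != 0.
  by rewrite twisted_numerator_at_0 // Num.Theory.pnatr_eq0 -lt0n.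
have [] := laurent_degree_quotient T0 H0 e5.
rewrite szT lcT H_size /leading_coefficient H_lead muln1 abszN => -> sz.
split; first by rewrite natz.
by move: sz; rewrite /p /q; nia.
Qed.
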